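(* Let $p\ge2$ and let $\mathcal{G}_1,\dots,\mathcal{G}_p$ be connected compact finite metric graphs, each with a non-empty set $D_i$ of Dirichlet pendant vertices, and for each $i$ fix a vertex $v_i\in D_i$. Let $\mathcal{G}$ be the graph obtained from the disjoint union $\bigsqcup_{i=1}^p\mathcal{G}_i$ by identifying $v_1,\dots,v_p$ to a single vertex endowed with standard (continuity and Kirchhoff) vertex conditions, all other vertex conditions being unchanged (so the Dirichlet set of $\mathcal{G}$ is $\bigsqcup_{i=1}^p(D_i\setminus\{v_i\})$). Suppose that $\lambda$ is a sharp eigenvalue of $L(\mathcal{G}_i,D_i)$ for every $i$, with $\lambda=\lambda_{n_i}(\mathcal{G}_i)$, where $n_i$ is the smallest index of $\lambda$ in the spectrum of $\mathcal{G}_i$. Then $\lambda$ is a sharp eigenvalue of $\mathcal{G}$, and $\lambda=\lambda_n(\mathcal{G})$ with smallest index $n=2-p+\sum_{i=1}^p n_i$.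
   Context: A compact finite metric graph $\mathcal{G}$ is the quotient of a disjoint union of finitely many compact intervals of positive length (edges) $e_i=[x_{2i-1},x_{2i}]$ by an equivalence relation on the set of endpoints; the equivalence classes are the vertices. Loops and multiple edges are allowed. The degree of a vertex is the number of interval endpoints in its class; a pendant vertex is a vertex of degree one. $\mathcal{L}$ denotes the total length (sum of the edge lengths) and $\beta=|E|-|V|+1$ the first Betti number. Given a subset $D$ of the pendant vertices (the Dirichlet vertices), $L(\mathcal{G},D)$ acts as $-\frac{d^2}{dx^2}$ on each edge, on functions $f\in\bigoplus_i H^2[x_{2i-1},x_{2i}]$ that are continuous on $\mathcal{G}$, satisfy $f(v)=0$ for all $v\in D$, and satisfy the Kirchhoff condition $\sum_{x_j\in v}\partial f(x_j)=0$ at every vertex $v\notin D$, where $\partial f(x_{2i-1})=f'(x_{2i-1})$ and $\partial f(x_{2i})=-f'(x_{2i})$. It is self-adjoint in $L_2(\mathcal{G})$ with discrete spectrum $0\le\lambda_1\le\lambda_2\le\dots$ (counted with multiplicity). Eigenvalues of a graph mean eigenvalues of its Laplacian. $\mathcal{D}=|D|$ and $\mathcal{N}$ is the number of pendant vertices not in $D$. Define for $n\in\mathbb{N}=\{1,2,\dots\}$ $$M_n=\frac{\pi^2}{\mathcal{L}^2}\Big(n-2+\mathcal{D}+\frac{\mathcal{N}+\beta}{2}+\beta\Big)^2,$$ and, for $n\ge2$, or for $n\geq 1$ if $\mathcal{D}\ne0$, $$m_n=\begin{cases}\frac{\pi^2}{\mathcal{L}^2}\frac{n^2}{4}& n<\mathcal{N}+\beta,\\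 \frac{\pi^2}{\mathcal{L}^2}\big(n-\frac{\mathcal{N}+\beta}{2}\big)^2& n\ge\mathcal{N}+\beta;\end{cases}$$ if $\mathcal{D}=0$ put $m_1=0$. $\lambda_n$ is lower sharp if $\lambda_n=m_n$ and upper sharp if $\lambda_n=M_n$. An eigenvalue $\lambda=\lambda_n=\dots=\lambda_{n+m-1}$ of multiplicity $m\ge1$ ($n$ the smallest index) is sharp if $\lambda_n$ is upper sharp and $\lambda_{n+m-1}$ is lower sharp. *)

(* Defs.v *)
From HB Require Import structures.
From mathcomp Require Import all_boot all_order all_algebra.
From mathcomp Require Import all_classical all_reals all_analysis.
Set Implicit Arguments.
Unset Strict Implicit.
Unset Printing Implicit Defensive.
Import Order.TTheory GRing.Theory Num.Theory.
Import numFieldNormedType.Exports.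
Local Open Scope classical_set_scope.
Local Open Scope ring_scope.

(* The endpoint (e, false) is the left end of the interval e, (e, true) its
   right end.  The equivalence relation on endpoints is the kernel of the
   surjection [attach]: the vertices are its classes, i.e. its fibres. *)
Record metric_graph (R : realType) := MetricGraph {
  edge : finType;
  vertex : finType;
  lo : edge -> R;
  hi : edge -> R;
  lo_lt_hi : forall e, lo e < hi e;
  attach : edge * bool -> vertex;
  attach_surj : forall w, exists x, attach x = w
}.

Section Combinatorics.
Variables (R : realType) (G : metric_graph R).

Definition position (x : edge G * bool) : R := if x.2 then hi x.1 else lo x.1.

Definition total_length : R := \sum_(e : edge G) (hi e - lo e).

Definition degree (w : vertex G) : nat :=
  #|[set x : edge G * bool | attach x == w]%SET|.

Definition pendant : {set vertex G} := [set w | degree w == 1]%SET.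

Definition adjacent : rel (vertex G) := fun u w =>
  [exists e : edge G, exists b : bool,
    (attach (e, b) == u) && (attach (e, ~~ b) == w)].

Definition connected_graph : Prop := forall u w, connect adjacent u w.

Definition betti : int := #|edge G|%:Z - #|vertex G|%:Z + 1.

End Combinatorics.

Section Laplacian.
Variables (R : realType) (G : metric_graph R) (D : {set vertex G}).

Local Notation leb := (@lebesgue_measure R).

(* f is in H^2[a, b], with (continuous) derivative f1 and second derivative
   f2 in L_2, unique up to null sets. *)
Definition is_H2 (a b : R) (f f1 f2 : R -> R) : Prop :=
  [/\ measurable_fun `[a, b] f2,
      leb.-integrable `[a, b] (fun x => (f2 x ^+ 2)%:E),
      forall x, x \in `[a, b] -> f1 x = f1 a + \int[leb]_(y in `[a, x]) f2 y &
      forall x, x \in `[a, b] -> f x = f a + \int[leb]_(y in `[a, x]) f1 y].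

(* Only the values of f e on [lo e, hi e] are relevant. *)
Definition graph_fun := edge G -> R -> R.

Definition end_value (f : graph_fun) (x : edge G * bool) : R :=
  f x.1 (position x).

Definition normal_derivative (f1 : graph_fun) (x : edge G * bool) : R :=
  if x.2 then - f1 x.1 (position x) else f1 x.1 (position x).

(* f is in the domain of L(G, D), with edgewise derivatives f1 and f2. *)
Definition in_domain (f f1 f2 : graph_fun) : Prop :=
  [/\ forall e, is_H2 (lo e) (hi e) (f e) (f1 e) (f2 e),
      forall x y, attach x = attach y -> end_value f x = end_value f y,
      forall x, attach x \in D -> end_value f x = 0 &
      forall w, w \notin D ->
        \sum_(x | attach x == w) normal_derivative f1 x = 0].

(* L f = mu f in L_2(G); f = 0 is allowed. *)
Definition in_eigenspace (mu : R) (f : graph_fun) : Prop :=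
  exists f1 f2 : graph_fun,
    in_domain f f1 f2 /\
    forall e, {ae leb, forall x, x \in `[lo e, hi e] -> - f2 e x = mu * f e x}.

Definition eq_on_graph (f g : graph_fun) : Prop :=
  forall e x, x \in `[lo e, hi e] -> f e x = g e x.

Definition lin_comb (m : nat) (c : 'I_m -> R) (F : 'I_m -> graph_fun) :
  graph_fun := fun e x => \sum_j c j * F j e x.

(* The eigenspace of mu has dimension m; m = 0 if mu is not an eigenvalue.
   Real-valued functions suffice, as L(G, D) has real coefficients. *)
Definition has_multiplicity (mu : R) (m : nat) : Prop :=
  exists F : 'I_m -> graph_fun,
    [/\ forall j, in_eigenspace mu (F j),
        forall c, eq_on_graph (lin_comb c F) (fun _ _ => 0) ->
          forall j, c j = 0 &
        forall f, in_eigenspace mu f ->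
          exists c, eq_on_graph f (lin_comb c F)].

(* s lists the eigenvalues smaller than mu, in nondecreasing order and with
   multiplicity. *)
Definition eigenvalues_below (mu : R) (s : seq R) : Prop :=
  [/\ sorted (fun x y : R => x <= y) s,
      all (fun nu => nu < mu) s &
      forall nu, nu < mu -> has_multiplicity nu (count_mem nu s)].

(* mu is the k-th eigenvalue (k >= 1), counted with multiplicity. *)
Definition is_eigenvalue_nr (k : nat) (mu : R) : Prop :=
  exists (s : seq R) (m : nat),
    [/\ eigenvalues_below mu s, has_multiplicity mu m &
        (size s < k <= size s + m)%N].

Definition smallest_index (n : nat) (mu : R) : Prop :=
  is_eigenvalue_nr n mu /\ forall k, is_eigenvalue_nr k mu -> (n <= k)%N.

Definition nb_dirichlet : nat := #|D|.

Definition nb_neumann : nat := #|pendant G :\: D|%SET.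

Definition upper_bound (n : nat) : R :=
  pi ^+ 2 / total_length G ^+ 2 *
  (n%:R - 2 + nb_dirichlet%:R + (nb_neumann%:R + (betti G)%:~R) / 2
   + (betti G)%:~R) ^+ 2.

Definition lower_bound (n : nat) : R :=
  if (nb_dirichlet == 0)%N && (n == 1)%N then 0
  else if n%:Z < nb_neumann%:Z + betti G then
    pi ^+ 2 / total_length G ^+ 2 * (n%:R ^+ 2 / 4)
  else
    pi ^+ 2 / total_length G ^+ 2 *
    (n%:R - (nb_neumann%:R + (betti G)%:~R) / 2) ^+ 2.

Definition upper_sharp (n : nat) (mu : R) : Prop :=
  is_eigenvalue_nr n mu /\ mu = upper_bound n.

Definition lower_sharp (n : nat) (mu : R) : Prop :=
  is_eigenvalue_nr n mu /\ mu = lower_bound n.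

Definition sharp_eigenvalue (mu : R) : Prop :=
  exists n m : nat,
    [/\ (0 < m)%N, has_multiplicity mu m, smallest_index n mu,
        upper_sharp n mu & lower_sharp (n + m - 1) mu].

End Laplacian.

Section Glue.
Variables (R : realType) (p : nat) (p_gt1 : (1 < p)%N).
Variables (G : 'I_p -> metric_graph R) (v : forall i, vertex (G i)).

Definition glue_edge : finType := {i : 'I_p & edge (G i)}.

Definition unglued (x : {i : 'I_p & vertex (G i)}) : bool :=
  tagged x != v (tag x).

(* None is the vertex obtained by identifying all the v i. *)
Definition glue_vertex : finType := option {x | unglued x}.

Definition glue_proj (i : 'I_p) (w : vertex (G i)) : glue_vertex :=
  insub (Tagged (fun i => vertex (G i)) w).

Definition glue_attach (x : glue_edge * bool) : glue_vertex :=
  glue_proj (attach (tagged x.1, x.2)).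

Lemma glue_lo_lt_hi (e : glue_edge) : lo (tagged e) < hi (tagged e).
Proof. exact: lo_lt_hi. Qed.

Lemma glue_attach_surj w : exists x, glue_attach x = w.
Proof.
case: w => [[[i w] hw]|].
- have [[e b] eb] := attach_surj w.
  exists (Tagged (fun i => edge (G i)) e, b).
  by rewrite /glue_attach /glue_proj /= eb insubT.
- pose i : 'I_p := Ordinal (ltnW p_gt1).
  have [[e b] eb] := attach_surj (v i).
  exists (Tagged (fun i => edge (G i)) e, b).
  by rewrite /glue_attach /glue_proj /= eb insubF // /unglued /= eqxx.
Qed.

Definition glue : metric_graph R :=
  @MetricGraph R glue_edge glue_vertex
    (fun e => lo (tagged e)) (fun e => hi (tagged e)) glue_lo_lt_hi
    glue_attach glue_attach_surj.

(* The disjoint union of the D i :\ v i. *)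
Definition glue_dirichlet (D : forall i, {set vertex (G i)}) :
  {set vertex glue} :=
  [set w : glue_vertex |
    if w is Some u then tagged (val u) \in D (tag (val u)) else false]%SET.

End Glue.

(* Main.v *)
(* Let w be the glued vertex.  For each nu let W(nu) be the space of solutions of
   - f'' = nu f that satisfy every condition of the glued graph except the
   Kirchhoff condition at w.  On W(nu) there are two functionals, the value val
   at w and the Kirchhoff sum kir at w; their kernels are the eigenspace of the
   disjoint union of the G_i (val = 0) and that of the glued graph (kir = 0).
   By Green's identity the image of (val, kir) is a line, and it turns
   monotonically with nu: the zeros (kir = 0) and the poles (val = 0) of the Weyl
   function kir / val alternate on [0, +oo[, beginning with a zero.  A pole lowers
   the multiplicity by one when passing from the disjoint union to the glued
   graph, a zero raises it by one.  So if lambda is a pole, the glued graph has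
   one more eigenvalue below lambda than the disjoint union, and the multiplicity
   of lambda drops by one; this is the claimed index, and it is sharp because the
   bounds add up.

   That lambda is a pole comes from sharpness.  Comparing the two bounds, the
   multiplicity of lambda in G_i is P + 2 beta - 1, with P the number of pendant
   vertices; but the eigenfunctions with zero derivative at the pendant vertex v_i
   vanish on its edge, and propagating these zero data through the graph leaves
   at most deg w - 2 free parameters at every other vertex w, hence dimension at
   most the sum of these, P + 2 beta - 2. *)

From HB Require Import structures.
Require Import Defs.
From mathcomp Require Import all_boot all_order all_algebra.
From mathcomp Require Import all_classical all_reals all_analysis.
From mathcomp Require Import measurable_realfun ring lra zify.
Set Implicit Arguments.
Unset Strict Implicit.
Unset Printing Implicit Defensive.
Import Order.TTheory GRing.Theory Num.Theory.
Import numFieldNormedType.Exports.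
Local Open Scope classical_set_scope.
Local Open Scope ring_scope.

(** * Calculus on a segment *)

Section Calculus.
Variable R : realType.
Implicit Types (f g F : R -> R) (a b x t : R).
Local Notation leb := (@lebesgue_measure R).

Lemma is_derive_continuous f f1 : (forall t, is_derive t 1 f (f1 t)) ->
  continuous f.
Proof.
by move=> df t; have [df1 _] := df t; apply/differentiable_continuous/derivable1_diffP.
Qed.

Lemma continuous_itv_integrable f a b : {within `[a, b], continuous f} ->
  leb.-integrable `[a, b] (EFin \o f).
Proof. by apply: continuous_compact_integrable; exact: segment_compact. Qed.

Lemma continuous_integrable f a b : continuous f ->
  leb.-integrable `[a, b] (EFin \o f).
Proof. by move=> cf; apply/continuous_itv_integrable/continuous_subspaceT. Qed.

Lemma is_deriveDf f g t df dg : is_derive t 1 f df -> is_derive t 1 g dg ->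
  is_derive t 1 (fun s => f s + g s) (df + dg).
Proof. exact: is_deriveD. Qed.

Lemma is_deriveMf f g t df dg : is_derive t 1 f df -> is_derive t 1 g dg ->
  is_derive t 1 (fun s => f s * g s) (f t * dg + g t * df).
Proof. exact: is_deriveM. Qed.

Lemma is_deriveZf f t c df : is_derive t 1 f df ->
  is_derive t 1 (fun s => c * f s) (c * df).
Proof. exact: is_deriveZ. Qed.

Lemma is_derive_scale f t c df : is_derive (c * t) 1 f df ->
  is_derive t 1 (fun s => f (c * s)) (c * df).
Proof.
move=> df1; rewrite mulrC; apply: is_derive1_comp.
rewrite -[X in is_derive _ _ _ X]mulr1; exact: is_deriveZf.
Qed.

Lemma is_derive_shift f t c df : is_derive (t - c) 1 f df ->
  is_derive t 1 (fun s => f (s - c)) df.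
Proof.
move=> df1; rewrite -[X in is_derive _ _ _ X]mulr1.
apply: (@is_derive1_comp _ f (fun s => s - c)).
by rewrite -[X in is_derive _ _ _ X]addr0; apply: is_deriveDf.
Qed.

Lemma is_derive_reflect f t c df : is_derive (c - t) 1 f df ->
  is_derive t 1 (fun s => f (c - s)) (- df).
Proof.
move=> df1; rewrite -[X in is_derive _ _ _ X]mulrN1.
apply: (@is_derive1_comp _ f (fun s => c - s)).
by rewrite -[X in is_derive _ _ _ X]add0r; apply: is_deriveDf.
Qed.

Lemma integral_derivative F f a b : a <= b ->
  (forall t, is_derive t 1 F (f t)) -> continuous f ->
  \int[leb]_(t in `[a, b]) f t = F b - F a.
Proof.
rewrite le_eqVlt => /predU1P[<- _ _|ab dF cf].
  by rewrite set_itv1 Rintegral_set1 subrr.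
have cF := is_derive_continuous dF.
rewrite /Rintegral (continuous_FTC2 (F := F) ab (continuous_subspaceT cf)) //.
- split => [t _||]; first by have [] := dF t.
  + exact: cvg_at_right_filter (cF a).
  + exact: cvg_at_left_filter (cF b).
- by move=> t _; rewrite derive1E derive_val.
Qed.

Section Primitive.
Variables (a b c : R) (f g : R -> R).
Hypotheses (ab : a < b)
  (fE : forall x, x \in `[a, b] -> f x = c + \int[leb]_(y in `[a, x]) g y).

Lemma primitive_continuous :
  leb.-integrable `[a, b] (EFin \o g) -> {within `[a, b], continuous f}.
Proof.
move=> ig; have cI := parameterized_integral_continuous (ltW ab) ig.
have : {within `[a, b], continuous
    (fun x => c + parameterized_integral lebesgue_measure a x g)}.
  by move=> x; apply: cvgD; [exact: cvg_cst | exact: cI].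
apply: subspace_eq_continuous => x; rewrite inE => xab.
by rewrite /from_subspace /= fE.
Qed.

Lemma primitive_is_derive x : {within `[a, b], continuous g} ->
  x \in `]a, b[ -> is_derive x 1 f (g x).
Proof.
move=> cg xab; have ig := continuous_itv_integrable cg.
have [ax xb] : a < x /\ x < b by move: xab; rewrite in_itv => /andP.
have cgx : {for x, continuous g}.
  by have [cg1 _ _] := (continuous_within_itvP g ab).1 cg; apply: cg1; rewrite inE.
have [dG G1] := continuous_FTC1_closed xb ig ax cgx.
apply: (near_eq_is_derive
  (f := fun y => c + \int[leb]_(t in `[a, y]) g t)).
  near=> y; rewrite fE //; apply: subset_itv_oo_cc.
  by near: y; exact: near_in_itvoo.
rewrite -[X in is_derive _ _ _ X]add0r; apply: is_deriveDf.
by rewrite -G1 derive1E; apply: derivableP.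
Unshelve. all: by end_near. Qed.

End Primitive.

Lemma zero_derivative_constant f a b : a <= b ->
  (forall t, t \in `]a, b[ -> is_derive t 1 f 0) ->
  {within `[a, b], continuous f} -> f b = f a.
Proof.
move=> ab df cf; have [c _] := MVT_segment ab df cf.
by rewrite mul0r => /eqP; rewrite subr_eq0 => /eqP.
Qed.

End Calculus.

(** * Solutions of -u'' = nu u *)

Section FundamentalSolutions.
Variable R : realType.
Implicit Types (nu t a b : R).
Local Notation leb := (@lebesgue_measure R).

(** [csol] and [ssol] are the solutions with Cauchy data (1, 0) and (0, 1) at 0; the exponentials
    spell out cosh and sinh. Negative nu is included because multiplicities are required at every
    real number below the eigenvalue. *)
Definition csol nu t : R :=
  if 0 <= nu then cos (Num.sqrt nu * t)
  else (expR (Num.sqrt (- nu) * t) + expR (- Num.sqrt (- nu) * t)) / 2.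

Definition ssol nu t : R :=
  if nu == 0 then t
  else if 0 <= nu then sin (Num.sqrt nu * t) / Num.sqrt nu
  else (expR (Num.sqrt (- nu) * t) - expR (- Num.sqrt (- nu) * t)) / 2 /
    Num.sqrt (- nu).

Lemma csol0 nu : csol nu 0 = 1.
Proof.
rewrite /csol !mulr0 cos0 expR0; case: ifP => // _.
by rewrite -mulr2n -[_ *+ 2]mulr_natr mul1r divff // pnatr_eq0.
Qed.

Lemma ssol0 nu : ssol nu 0 = 0.
Proof.
by rewrite /ssol !mulr0 sin0 subrr !mul0r; case: ifP => // _; case: ifP.
Qed.

Lemma csol_derive nu t : is_derive t 1 (csol nu) (- nu * ssol nu t).
Proof.
have [nu_ge0|nu_lt0] := leP 0 nu.
- have -> : csol nu = fun s => cos (Num.sqrt nu * s).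
    by apply/funext => s; rewrite /csol nu_ge0.
  apply: (is_derive_eq (is_derive_scale (f := @cos R) (is_derive_cos _))).
  rewrite /ssol; have [->|nu_neq0] := eqVneq nu 0.
    by rewrite sqrtr0 oppr0 !mul0r.
  have k0 : Num.sqrt nu != 0 by rewrite sqrtr_eq0 -ltNge lt_def nu_neq0.
  rewrite nu_ge0; have := sqr_sqrtr nu_ge0.
  by move: (Num.sqrt nu) k0 => k k0 <-; field.
- have -> : csol nu = fun s => 2^-1 * (expR (Num.sqrt (- nu) * s)
      + expR (- Num.sqrt (- nu) * s)).
    by apply/funext => s; rewrite /csol leNgt nu_lt0 /= mulrC.
  apply: (is_derive_eq (is_deriveZf _ (is_deriveDf
    (is_derive_scale (f := expR) (is_derive_expR _))
    (is_derive_scale (f := expR) (is_derive_expR _))))).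
  rewrite /ssol lt_eqF // leNgt nu_lt0 /=.
  have k0 : Num.sqrt (- nu) != 0 by rewrite sqrtr_eq0 -ltNge oppr_gt0.
  have := @sqr_sqrtr _ (- nu); rewrite oppr_ge0 (ltW nu_lt0) => /(_ isT).
  by move: (Num.sqrt (- nu)) k0 => k k0 <-; field.
Qed.

Lemma ssol_derive nu t : is_derive t 1 (ssol nu) (csol nu t).
Proof.
have [nu0|nu_neq0] := eqVneq nu 0.
  have -> : ssol nu = id by apply/funext => s; rewrite /ssol nu0 eqxx.
  rewrite /csol nu0 lexx sqrtr0 mul0r cos0; exact: is_derive_id.
have [nu_ge0|nu_lt0] := leP 0 nu.
- have -> : ssol nu = fun s => (Num.sqrt nu)^-1 * sin (Num.sqrt nu * s).
    by apply/funext => s; rewrite /ssol nu_ge0 (negbTE nu_neq0) mulrC.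
  apply: (is_derive_eq
    (is_deriveZf _ (is_derive_scale (f := @sin R) (is_derive_sin _)))).
  by rewrite /csol nu_ge0 mulKf // sqrtr_eq0 -ltNge lt_def nu_neq0.
- have -> : ssol nu = fun s => (Num.sqrt (- nu))^-1 * 2^-1 *
      (expR (Num.sqrt (- nu) * s) + - 1 * expR (- Num.sqrt (- nu) * s)).
    apply/funext => s; rewrite /ssol leNgt nu_lt0 /= (negbTE nu_neq0) mulN1r.
    by rewrite -[LHS]mulrA [LHS]mulrC; congr (_ * _); exact: mulrC.
  apply: (is_derive_eq (is_deriveZf _ (is_deriveDf
    (is_derive_scale (f := expR) (is_derive_expR _))
    (is_deriveZf _ (is_derive_scale (f := expR) (is_derive_expR _)))))).
  rewrite /csol leNgt nu_lt0 /=.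
  have k0 : Num.sqrt (- nu) != 0 by rewrite sqrtr_eq0 -ltNge oppr_gt0.
  by field.
Qed.

(* The general solution of u'' = - nu u in terms of u(0) = a, u'(0) = b. *)
Definition usol nu a b t : R := a * csol nu t + b * ssol nu t.
Definition dusol nu a b t : R := - nu * a * ssol nu t + b * csol nu t.

Lemma usol_derive nu a b t : is_derive t 1 (usol nu a b) (dusol nu a b t).
Proof.
apply: (is_derive_eq (is_deriveDf
  (is_deriveZf _ (csol_derive _ _)) (is_deriveZf _ (ssol_derive _ _)))).
by rewrite /dusol; ring.
Qed.

Lemma dusol_derive nu a b t :
  is_derive t 1 (dusol nu a b) (- nu * usol nu a b t).
Proof.
apply: (is_derive_eq (is_deriveDf
  (is_deriveZf _ (ssol_derive _ _)) (is_deriveZf _ (csol_derive _ _)))).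
by rewrite /usol; ring.
Qed.

Lemma usol_continuous nu a b : continuous (usol nu a b).
Proof. exact/is_derive_continuous/usol_derive. Qed.

Lemma dusol_continuous nu a b : continuous (dusol nu a b).
Proof. exact/is_derive_continuous/dusol_derive. Qed.

Lemma usol0 nu a b : usol nu a b 0 = a.
Proof. by rewrite /usol csol0 ssol0 mulr1 mulr0 addr0. Qed.

Lemma dusol0 nu a b : dusol nu a b 0 = b.
Proof. by rewrite /dusol csol0 ssol0 mulr1 mulr0 add0r. Qed.

(** The left side is the determinant of the matrix that carries Cauchy data at 0 to Cauchy data at
    t; its derivative in t vanishes. *)
Lemma csol_ssol nu t : csol nu t ^+ 2 + nu * ssol nu t ^+ 2 = 1.
Proof.
rewrite !expr2; have -> : 1 = csol nu 0 * csol nu 0 + nu * (ssol nu 0 * ssol nu 0).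
  by rewrite csol0 ssol0 mulr1 !mulr0 addr0.
apply: (is_derive_0_is_cst
  (f := fun s => csol nu s * csol nu s + nu * (ssol nu s * ssol nu s))) => s.
apply: (is_derive_eq (is_deriveDf
  (is_deriveMf (csol_derive _ _) (csol_derive _ _))
  (is_deriveZf _ (is_deriveMf (ssol_derive _ _) (ssol_derive _ _))))).
by ring.
Qed.

(** Carrying the Cauchy data at t forward to b gives two functions of t whose derivatives vanish;
    their values at t = a and t = b are compared. *)
Lemma solution_unique nu a b (f f1 : R -> R) : a <= b ->
  {within `[a, b], continuous f} -> {within `[a, b], continuous f1} ->
  (forall t, t \in `]a, b[ -> is_derive t 1 f (f1 t)) ->
  (forall t, t \in `]a, b[ -> is_derive t 1 f1 (- nu * f t)) ->
  f b = usol nu (f a) (f1 a) (b - a) /\ f1 b = dusol nu (f a) (f1 a) (b - a).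
Proof.
move=> ab cf cf1 df df1.
have cC : {within `[a, b], continuous (fun t => csol nu (b - t))}.
  apply/continuous_subspaceT/is_derive_continuous => t.
  exact/is_derive_reflect/csol_derive.
have cS : {within `[a, b], continuous (fun t => ssol nu (b - t))}.
  apply/continuous_subspaceT/is_derive_continuous => t.
  exact/is_derive_reflect/ssol_derive.
split.
- have := @zero_derivative_constant R
    (fun t => f t * csol nu (b - t) + f1 t * ssol nu (b - t)) a b ab.
  rewrite subrr csol0 ssol0 mulr1 mulr0 addr0; apply.
    move=> t tab; apply: (is_derive_eq (is_deriveDf
      (is_deriveMf (df t tab) (is_derive_reflect (csol_derive _ _)))
      (is_deriveMf (df1 t tab) (is_derive_reflect (ssol_derive _ _))))).
    by ring.
  by move=> t; apply: cvgD; apply: cvgM; [exact: cf|exact: cC|exact: cf1|exact: cS].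
- have := @zero_derivative_constant R
    (fun t => - nu * (f t * ssol nu (b - t)) + f1 t * csol nu (b - t)) a b ab.
  rewrite subrr csol0 ssol0 mulr1 !mulr0 add0r mulrA; apply.
    move=> t tab; apply: (is_derive_eq (is_deriveDf
      (is_deriveZf _
        (is_deriveMf (df t tab) (is_derive_reflect (ssol_derive _ _))))
      (is_deriveMf (df1 t tab) (is_derive_reflect (csol_derive _ _))))).
    by ring.
  move=> t; apply: cvgD; last by apply: cvgM; [exact: cf1|exact: cC].
  by apply: cvgM; [exact: cvg_cst|apply: cvgM; [exact: cf|exact: cS]].
Qed.

(** Domination by 1 + f^2, where the constant is integrable since the segment is bounded. *)
Lemma sqr_integrable (a b : R) (f : R -> R) : measurable_fun `[a, b] f ->
  leb.-integrable `[a, b] (fun x => (f x ^+ 2)%:E) ->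
  leb.-integrable `[a, b] (EFin \o f).
Proof.
move=> mf if2.
have mD : measurable (`[a, b] : set (measurableTypeR R)) by [].
apply: (le_integrable mD (f := EFin \o f) (g := fun x => (1 + f x ^+ 2)%:E)).
- exact/measurable_EFinP.
- move=> x _ /=; rewrite lee_fin [leRHS]ger0_norm ?addr_ge0 ?sqr_ge0 //.
  rewrite -(real_normK (num_real (f x))); have := normr_ge0 (f x); move: `|f x| => y y0.
  by have := sqr_ge0 (y - 1); nra.
- have : leb.-integrable `[a, b] (EFin \o fun=> 1 : R).
    by apply: continuous_integrable => x; exact: cvg_cst.
  by move=> i1; exact: (integrableD _ i1 if2).
Qed.

(** Regularity bootstrap: f1 is continuous as a primitive of an integrable function, hence so is f;
    the equation then makes f1 a primitive of the continuous function - nu f, and f is a classical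
    solution. *)
Lemma H2_solution nu a b (f f1 f2 : R -> R) : a < b ->
  is_H2 a b f f1 f2 ->
  {ae leb, forall x, x \in `[a, b] -> - f2 x = nu * f x} ->
  forall x, x \in `[a, b] ->
    f x = usol nu (f a) (f1 a) (x - a) /\ f1 x = dusol nu (f a) (f1 a) (x - a).
Proof.
move=> ab [mf2 if2 f1E fE] aef.
have cf1 := primitive_continuous ab f1E (sqr_integrable mf2 if2).
have cf := primitive_continuous ab fE (continuous_itv_integrable cf1).
have cnf : {within `[a, b], continuous (fun x => - nu * f x)}.
  by move=> x; apply: cvgM; [exact: cvg_cst | exact: cf].
have f1E' x : x \in `[a, b] ->
    f1 x = f1 a + \int[leb]_(y in `[a, x]) (- nu * f y).
  move=> xab; rewrite f1E //; congr (_ + fine _).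
  have sub : `[a, x] `<=` `[a, b].
    move: xab; rewrite in_itv /= => /andP[_ xb].
    by apply: subset_itvl; rewrite bnd_simp.
  apply: ae_eq_integral => //.
  - by apply/measurable_EFinP; apply: measurable_funS mf2.
  - apply: (measurable_int leb); apply: integrableS (continuous_itv_integrable cnf) => //.
  - apply: filterS aef; first exact: (ae_filter_ringOfSetsType leb).
    by move=> y ey /sub yab; rewrite /= mulNr -ey ?opprK.
(* [solution_unique] relates the two ends of a segment, so it is applied on [a, x]. *)
move=> x xab; have [ax xb] : a <= x /\ x <= b by move: xab; rewrite in_itv => /andP.
have sub : `[a, x] `<=` `[a, b] by apply: subset_itvl; rewrite bnd_simp.
have sub' t : t \in `]a, x[ -> t \in `]a, b[.
  by rewrite !in_itv /= => /andP[-> tx]; exact: lt_le_trans xb.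
apply: solution_unique => //.
- exact: continuous_subspaceW cf.
- exact: continuous_subspaceW cf1.
- by move=> t /sub' tab; exact: (primitive_is_derive ab fE).
- by move=> t /sub' tab; exact: (primitive_is_derive ab f1E').
Qed.

Lemma usol_H2 nu a b c d : is_H2 a b (fun x => usol nu c d (x - a))
  (fun x => dusol nu c d (x - a)) (fun x => - nu * usol nu c d (x - a)).
Proof.
have du (x : R) : is_derive x 1 (fun x => usol nu c d (x - a)) (dusol nu c d (x - a)).
  exact/is_derive_shift/usol_derive.
have ddu (x : R) : is_derive x 1 (fun x => dusol nu c d (x - a))
    (- nu * usol nu c d (x - a)).
  exact/is_derive_shift/dusol_derive.
have cu := is_derive_continuous du; have cdu := is_derive_continuous ddu.
have cf2 : continuous (fun x => - nu * usol nu c d (x - a)).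
  by move=> x; apply: cvgM; [exact: cvg_cst | exact: cu].
split.
- by apply: measurable_funTS; exact: continuous_measurable_fun.
- by apply: continuous_integrable => x; apply: cvgM; exact: cf2.
- move=> x; rewrite in_itv /= => /andP[ax _].
  by rewrite (integral_derivative ax ddu cf2) [RHS]addrC subrK.
- move=> x; rewrite in_itv /= => /andP[ax _].
  by rewrite (integral_derivative ax du cdu) [RHS]addrC subrK.
Qed.

End FundamentalSolutions.

(** * Identities and estimates on a single edge *)

Section EdgeIntegrals.
Variable R : realType.
Implicit Types (nu t a b l : R).
Local Notation leb := (@lebesgue_measure R).

Lemma usolM_integrable nu a b nu' a' b' l : leb.-integrable `[0, l]
  (EFin \o (fun t => usol nu a b t * usol nu' a' b' t)).
Proof.
by apply: continuous_integrable => t; apply: cvgM; exact: usol_continuous.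
Qed.

(** The integrand times nu - nu' is the derivative of the Wronskian u v' - u' v. *)
Lemma edge_green nu a b nu' a' b' l : 0 <= l ->
  (nu - nu') * \int[leb]_(t in `[0, l]) (usol nu a b t * usol nu' a' b' t) =
  usol nu a b l * dusol nu' a' b' l - dusol nu a b l * usol nu' a' b' l -
  (a * b' - b * a').
Proof.
move=> l_ge0; rewrite -RintegralZl //; last exact: usolM_integrable.
have dF t : is_derive t 1 (fun t => usol nu a b t * dusol nu' a' b' t +
                 -1 * (dusol nu a b t * usol nu' a' b' t))
    ((nu - nu') * (usol nu a b t * usol nu' a' b' t)).
  apply: (is_derive_eq (is_deriveDf
    (is_deriveMf (usol_derive _ _ _ _) (dusol_derive _ _ _ _))
    (is_deriveZf _ (is_deriveMf (dusol_derive _ _ _ _) (usol_derive _ _ _ _))))).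
  by ring.
rewrite (integral_derivative l_ge0 dF); first by rewrite !usol0 !dusol0; ring.
move=> t; apply: cvgM; first exact: cvg_cst.
by apply: cvgM; exact: usol_continuous.
Qed.

Lemma edge_energy nu a b l : 0 <= l ->
  \int[leb]_(t in `[0, l]) (dusol nu a b t ^+ 2) -
    nu * \int[leb]_(t in `[0, l]) (usol nu a b t ^+ 2) =
  usol nu a b l * dusol nu a b l - a * b.
Proof.
move=> l_ge0.
have cu : continuous (fun t => usol nu a b t ^+ 2).
  by move=> t; apply: cvgM; exact: usol_continuous.
have cdu : continuous (fun t => dusol nu a b t ^+ 2).
  by move=> t; apply: cvgM; exact: dusol_continuous.
have cnu : continuous (fun t => nu * usol nu a b t ^+ 2).
  by move=> t; apply: cvgM; [exact: cvg_cst | exact: cu].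
rewrite -RintegralZl //; last exact: continuous_integrable.
rewrite -RintegralB //; try exact: continuous_integrable.
have dF t : is_derive t 1 (fun t => usol nu a b t * dusol nu a b t)
    (dusol nu a b t ^+ 2 - nu * usol nu a b t ^+ 2).
  apply: (is_derive_eq
    (is_deriveMf (usol_derive _ _ _ _) (dusol_derive _ _ _ _))).
  by ring.
rewrite (integral_derivative l_ge0 dF); first by rewrite usol0 dusol0.
by move=> t; apply: cvgB; [exact: cdu | exact: cnu].
Qed.

(** The integral of f^2 over [0, x] lies between 0 and the total, hence vanishes for all x inside;
    its derivative is f^2. *)
Lemma continuous_sqr_integral0 (f : R -> R) l t : continuous f ->
  \int[leb]_(s in `[0, l]) (f s ^+ 2) = 0 -> t \in `]0, l[ -> f t = 0.
Proof.
move=> cf int0 /[dup] tl; rewrite in_itv /= => /andP[t0 tl'].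
have cf2 : continuous (fun s => f s ^+ 2) by move=> s; apply: cvgM; exact: cf.
have if2 x y : leb.-integrable `[x, y] (EFin \o (fun s => f s ^+ 2)).
  exact: continuous_integrable.
have prim0 x : x \in `]0, l[ -> \int[leb]_(s in `[0, x]) (f s ^+ 2) = 0.
  rewrite in_itv /= => /andP[x0 xl].
  apply/eqP; rewrite eq_le Rintegral_ge0 ?andbT; last by move=> s _; exact: sqr_ge0.
  have := @Rintegral_itvB R (fun s => f s ^+ 2) (BLeft 0) (BRight l) x (if2 0 l).
  rewrite !bnd_simp => /(_ (ltW x0) (ltW xl)); rewrite int0 sub0r => /eqP.
  rewrite eqr_oppLR => /eqP ->.
  by rewrite oppr_le0; apply: Rintegral_ge0 => s _; exact: sqr_ge0.
have [dF F1] := continuous_FTC1_closed tl' (if2 0 l) t0 (cf2 t).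
move: F1; rewrite derive1E (near_eq_derive (g := cst 0)).
  by rewrite derive_val => /esym/eqP; rewrite sqrf_eq0 => /eqP.
by near=> x; rewrite prim0 //; near: x; exact: near_in_itvoo.
Unshelve. all: by end_near. Qed.

(** The propagation of Cauchy data is invertible, its determinant being 1 by [csol_ssol]. *)
Lemma cauchy_eq0 nu a b t :
  usol nu a b t = 0 -> dusol nu a b t = 0 -> a = 0 /\ b = 0.
Proof.
have := csol_ssol nu t; rewrite /usol /dusol.
move: (csol _ _) (ssol _ _) => c s e3 e1 e2; split.
  have : c * (a * c + b * s) - s * (- nu * a * s + b * c) = a * (c ^+ 2 + nu * s ^+ 2).
    by ring.
  by rewrite e1 e2 e3 !mulr0 subr0 mulr1.
have : nu * s * (a * c + b * s) + c * (- nu * a * s + b * c) = b * (c ^+ 2 + nu * s ^+ 2).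
  by ring.
by rewrite e1 e2 e3 !mulr0 addr0 mulr1.
Qed.

(** The solution vanishes on the open interval, so its Cauchy data vanish at the midpoint and
    therefore at 0. *)
Lemma usol_eq0 nu a b l : 0 < l ->
  \int[leb]_(t in `[0, l]) (usol nu a b t ^+ 2) = 0 -> a = 0 /\ b = 0.
Proof.
move=> l_gt0 int0.
have u0 t : t \in `]0, l[ -> usol nu a b t = 0.
  exact: (continuous_sqr_integral0 (@usol_continuous R nu a b) int0).
have l2 : l / 2 \in `]0, l[ by rewrite in_itv /=; apply/andP; split; lra.
have du0 : dusol nu a b (l / 2) = 0.
  have [_ <-] := usol_derive nu a b (l / 2).
  rewrite (near_eq_derive (g := cst 0)) ?derive_val //.
  by near=> x; rewrite u0 //; near: x; exact: near_in_itvoo.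
exact: cauchy_eq0 (u0 _ l2) du0.
Unshelve. all: by end_near. Qed.

Lemma cos_lipschitz (x y : R) : `|cos x - cos y| <= `|x - y|.
Proof.
wlog xy : x y / x <= y.
  by move=> H; have [/H//|/ltW/H] := leP x y; rewrite distrC (distrC y).
have [|c _ e] := @MVT_segment _ (@cos R) (fun t => - sin t) x y xy.
- exact/continuous_subspaceT/continuous_cos.
- rewrite distrC (distrC x) e normrM normrN ler_piMl // ler_norml.
  by rewrite sin_geN1 sin_le1.
Qed.

Lemma csol_le1 nu t : 0 <= nu -> `|csol nu t| <= 1.
Proof. by move=> nu0; rewrite /csol nu0 cos_max. Qed.

Lemma csol_lipschitz nu nu' t : 0 <= nu -> 0 <= nu' -> 0 <= t ->
  `|csol nu t - csol nu' t| <= `|Num.sqrt nu - Num.sqrt nu'| * t.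
Proof.
move=> h h' t0; rewrite /csol h h' (le_trans (cos_lipschitz _ _)) //.
by rewrite -mulrBl normrM (ger0_norm t0).
Qed.

Lemma ssol_le nu t : 0 <= nu -> 0 <= t -> `|ssol nu t| <= t.
Proof.
move=> h t0; have [||c _] := @MVT_segment _ (ssol nu) (csol nu) 0 t t0.
- by move=> s _; exact: ssol_derive.
- exact/continuous_subspaceT/is_derive_continuous/ssol_derive.
- rewrite ssol0 !subr0 => ->; rewrite normrM (ger0_norm t0).
  by rewrite ler_piMl // csol_le1.
Qed.

(** The difference vanishes at 0 and its t-derivative is controlled by [csol_lipschitz]; this way
    the division by the square root of nu, singular at nu = 0, never enters. *)
Lemma ssol_lipschitz nu nu' t : 0 <= nu -> 0 <= nu' -> 0 <= t ->
  `|ssol nu t - ssol nu' t| <= `|Num.sqrt nu - Num.sqrt nu'| * t * t.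
Proof.
move=> h h' t0; have [||c ct] := @MVT_segment _
  (fun s => ssol nu s + -1 * ssol nu' s) (fun s => csol nu s + -1 * csol nu' s)
  0 t t0.
- move=> s _; apply: is_deriveDf; first exact: ssol_derive.
  exact/is_deriveZf/ssol_derive.
- apply/continuous_subspaceT/is_derive_continuous => s.
  apply: is_deriveDf; first exact: ssol_derive.
  exact/is_deriveZf/ssol_derive.
- rewrite !ssol0 mulr0 addr0 !subr0 !mulN1r => ->.
  move: ct; rewrite in_itv /= => /andP[c0 ct].
  rewrite normrM (ger0_norm t0) ler_wpM2r //.
  by rewrite (le_trans (csol_lipschitz h h' c0)) // ler_wpM2l.
Qed.

Section Limit.
Variables (nu_ a_ b_ : nat -> R) (nu a b : R).
Hypotheses (nu_ge0 : forall n, 0 <= nu_ n) (nu0 : 0 <= nu)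
  (cnu : nu_ n @[n --> \oo] --> nu) (ca : a_ n @[n --> \oo] --> a)
  (cb : b_ n @[n --> \oo] --> b).

(** Bounds the distance between the n-th and the limit solution at t. It is nondecreasing in t >= 0,
    so [eta n l] works on all of [0, l] and the limit can be taken under the integral. *)
Let eta n t := `|a_ n - a| + `|a| * (`|Num.sqrt (nu_ n) - Num.sqrt nu| * t) +
  `|b_ n - b| * t + `|b| * (`|Num.sqrt (nu_ n) - Num.sqrt nu| * t * t).

Let dist_cvg (u : nat -> R) (x : R) : u n @[n --> \oo] --> x ->
  `|u n - x| @[n --> \oo] --> 0.
Proof.
move=> ux; rewrite -(@normr0 _ R) -(subrr x); apply: cvg_norm.
by apply: cvgB => //; exact: cvg_cst.
Qed.

Let sqrt_dist_cvg : `|Num.sqrt (nu_ n) - Num.sqrt nu| @[n --> \oo] --> 0.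
Proof.
by apply: dist_cvg; exact: cvg_comp cnu (@sqrt_continuous R nu).
Qed.

Let eta_cvg t : eta n t @[n --> \oo] --> 0.
Proof.
have -> : 0 = 0 + `|a| * (0 * t) + 0 * t + `|b| * (0 * t * t) :> R.
  by rewrite !mul0r !mulr0 !addr0.
apply: cvgD; last by apply: cvgMr; apply: cvgMl; apply: cvgMl.
apply: cvgD; last by apply: cvgMl; exact: dist_cvg.
by apply: cvgD; [exact: dist_cvg|apply: cvgMr; exact: cvgMl].
Qed.

Let usol_dist n t : 0 <= t ->
  `|usol (nu_ n) (a_ n) (b_ n) t - usol nu a b t| <= eta n t.
Proof.
move=> t0; have -> : usol (nu_ n) (a_ n) (b_ n) t - usol nu a b t =
    (a_ n - a) * csol (nu_ n) t + a * (csol (nu_ n) t - csol nu t) +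
    (b_ n - b) * ssol (nu_ n) t + b * (ssol (nu_ n) t - ssol nu t).
  by rewrite /usol; ring.
rewrite /eta.
rewrite (le_trans (ler_normD _ _)) // lerD //; last first.
  by rewrite normrM ler_wpM2l // ssol_lipschitz.
rewrite (le_trans (ler_normD _ _)) // lerD //; last first.
  by rewrite normrM ler_wpM2l // ssol_le.
rewrite (le_trans (ler_normD _ _)) // lerD //; last first.
  by rewrite normrM ler_wpM2l // csol_lipschitz.
by rewrite normrM ler_piMr // csol_le1.
Qed.

Let dist_le_cvg (u e : nat -> R) (x : R) : (forall n, `|u n - x| <= e n) ->
  e n @[n --> \oo] --> 0 -> u n @[n --> \oo] --> x.
Proof.
move=> ue e0; apply/cvgrPdistC_le => eps eps0; near=> n.
rewrite (le_trans (ue n)) // (le_trans (ler_norm _)) //.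
by near: n; exact: cvgr0_norm_le.
Unshelve. all: by end_near. Qed.

Lemma csol_cvg t : 0 <= t -> csol (nu_ n) t @[n --> \oo] --> csol nu t.
Proof.
move=> t0; apply: (dist_le_cvg (fun n => csol_lipschitz (nu_ge0 n) nu0 t0)).
rewrite -(mul0r t); apply: cvgMl; exact: sqrt_dist_cvg.
Qed.

Lemma ssol_cvg t : 0 <= t -> ssol (nu_ n) t @[n --> \oo] --> ssol nu t.
Proof.
move=> t0; apply: (dist_le_cvg (fun n => ssol_lipschitz (nu_ge0 n) nu0 t0)).
rewrite -(mul0r t) -(mul0r t); do 2!apply: cvgMl; exact: sqrt_dist_cvg.
Qed.

Lemma usol_cvg t : 0 <= t ->
  usol (nu_ n) (a_ n) (b_ n) t @[n --> \oo] --> usol nu a b t.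
Proof.
move=> t0.
by apply: cvgD; apply: cvgM => //; [exact: csol_cvg | exact: ssol_cvg].
Qed.

Lemma dusol_cvg t : 0 <= t ->
  dusol (nu_ n) (a_ n) (b_ n) t @[n --> \oo] --> dusol nu a b t.
Proof.
move=> t0; apply: cvgD; last by apply: cvgM => //; exact: csol_cvg.
by apply: cvgM; [apply: cvgM; first exact: cvgN|exact: ssol_cvg].
Qed.

Lemma usolM_integral_cvg nu' a' b' l : 0 <= l ->
  \int[leb]_(t in `[0, l]) (usol (nu_ n) (a_ n) (b_ n) t * usol nu' a' b' t)
    @[n --> \oo] -->
  \int[leb]_(t in `[0, l]) (usol nu a b t * usol nu' a' b' t).
Proof.
move=> l0; pose I := \int[leb]_(t in `[0, l]) `|usol nu' a' b' t|.
have cg : continuous (fun t => `|usol nu' a' b' t|).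
  by move=> t; apply: cvg_norm; exact: usol_continuous.
apply: (@dist_le_cvg _ (fun n => eta n l * I)) => [n|]; last first.
  by rewrite -(mul0r I); apply: cvgMl; exact: eta_cvg.
rewrite -RintegralB //; try exact: usolM_integrable.
have cd : continuous (fun t => usol (nu_ n) (a_ n) (b_ n) t * usol nu' a' b' t -
    usol nu a b t * usol nu' a' b' t).
  by move=> t; apply: cvgB; apply: cvgM; exact: usol_continuous.
rewrite (le_trans (le_normr_Rintegral _ (continuous_integrable 0 l cd))) //.
rewrite -RintegralZl //; last exact: continuous_integrable.
apply: le_Rintegral => //.
- by apply: continuous_integrable => t; apply: cvg_norm; exact: cd.
- by apply: continuous_integrable => t; apply: cvgMr; exact: cg.
move=> t /=; rewrite in_itv /= => /andP[t0 tl].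
rewrite -mulrBl normrM ler_wpM2r // (le_trans (usol_dist n t0)) //.
by rewrite /eta !lerD // !ler_wpM2l // ?ler_pM // ?mulr_ge0 // ler_wpM2l.
Qed.

End Limit.

End EdgeIntegrals.

(** * Linear functionals and dimension *)

Lemma linfun_linear (K : fieldType) (aT rT : vectType K) (f : aT -> rT) :
  linear f -> linfun f =1 f.
Proof.
move=> linf.
pose g : {linear aT -> rT} := HB.pack f (GRing.isLinear.Build _ _ _ _ f linf).
exact: (lfunE g).
Qed.

Section Functionals.
Variables (K : fieldType) (vT : vectType K).
Implicit Types U : {vspace vT}.

Lemma dim_lker_functional (h : 'Hom(vT, K^o)) U :
  \dim U = (\dim (U :&: lker h) + ~~ (U <= lker h)%VS)%N.
Proof.
rewrite -(limg_ker_dim h U); congr addn; apply/eqP.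
have le1 : (\dim (h @: U) <= 1)%N.
  by rewrite (leq_trans (dimvS (subvf _))) // dimvf /dim /=.
have : (\dim (h @: U) == 0)%N = (U <= lker h)%VS.
  by rewrite dimv_eq0 lkerE.
by case: (U <= _)%VS; case: (\dim _) le1 => [|[]].
Qed.

Lemma dim_bigcap_lker (I : finType) (P : pred I) (h : I -> 'Hom(vT, K^o)) U :
  (\dim U <= \dim (U :&: \bigcap_(i | P i) lker (h i))%VS + #|P|)%N.
Proof.
rewrite -sum1_card; elim/big_rec2: _ U => [|i k W Pi IH] U.
  by rewrite capvf addn0.
rewrite (leq_trans (IH U)) // (dim_lker_functional (h i) (U :&: W)).
by rewrite -capvA [(W :&: _)%VS]capvC -addnA leq_add2l leq_add2r leq_b1.
Qed.

Lemma mem_bigcap_lker (I : finType) (P : pred I) (h : I -> 'Hom(vT, K^o)) x :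
  (x \in (\bigcap_(i | P i) lker (h i))%VS) = [forall i, P i ==> (h i x == 0)].
Proof.
rewrite memvE; apply/subv_bigcapP/forall_inP => xh i Pi.
  by have := xh i Pi; rewrite -memvE memv_ker.
by rewrite -memvE memv_ker xh.
Qed.

End Functionals.

(** * Eigenspaces in coordinates *)

Section Coordinates.
Variables (R : realType) (G : metric_graph R).
Local Notation leb := (@lebesgue_measure R).
Local Notation endpoint := (edge G * bool)%type.
Implicit Types (D : {set vertex G}) (nu : R) (e : edge G) (z : endpoint)
  (w : vertex G).

(* A solution of - f'' = nu f on every edge is encoded by its values (false)
   and derivatives (true) at the left ends of the edges. *)
Definition coords := 'rV[R]_#|{: endpoint}|.
Implicit Types x y : coords.

Definition cdata x z : R := x 0 (enum_rank z).

Definition edge_length e := hi e - lo e.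

Lemma edge_length_gt0 e : 0 < edge_length e.
Proof. by rewrite subr_gt0 lo_lt_hi. Qed.

Definition edge_sol nu x e : R -> R := usol nu (cdata x (e, false)) (cdata x (e, true)).

Definition graph_sol nu x : graph_fun G := fun e t => edge_sol nu x e (t - lo e).

Definition end_val nu x z : R :=
  if z.2 then edge_sol nu x z.1 (edge_length z.1) else cdata x (z.1, false).

Definition end_der nu x z : R :=
  if z.2 then
    - dusol nu (cdata x (z.1, false)) (cdata x (z.1, true)) (edge_length z.1)
  else cdata x (z.1, true).

Lemma cdata_is_linear z c x y : cdata (c *: x + y) z = c * cdata x z + cdata y z.
Proof. by rewrite /cdata !mxE. Qed.

Lemma edge_sol_is_linear nu e t c x y :
  edge_sol nu (c *: x + y) e t = c * edge_sol nu x e t + edge_sol nu y e t.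
Proof. by rewrite /edge_sol /usol !cdata_is_linear; ring. Qed.

Lemma end_val_is_linear nu z c x y :
  end_val nu (c *: x + y) z = c * end_val nu x z + end_val nu y z.
Proof.
by rewrite /end_val; case: z.2; rewrite ?edge_sol_is_linear ?cdata_is_linear.
Qed.

Lemma end_der_is_linear nu z c x y :
  end_der nu (c *: x + y) z = c * end_der nu x z + end_der nu y z.
Proof.
by rewrite /end_der; case: z.2; rewrite /dusol !cdata_is_linear //; ring.
Qed.

Definition kirchhoff nu w x : R := \sum_(z | attach z == w) end_der nu x z.

Lemma kirchhoff_is_linear nu w c x y :
  kirchhoff nu w (c *: x + y) = c * kirchhoff nu w x + kirchhoff nu w y.
Proof.
rewrite /kirchhoff mulr_sumr -big_split /=; apply: eq_bigr => z _.
exact: end_der_is_linear.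
Qed.

Definition some_end w : endpoint := projT1 (cid (attach_surj w)).

Lemma some_endK w : attach (some_end w) = w.
Proof. exact: projT2 (cid (attach_surj w)). Qed.

Definition vertex_val nu w x : R := end_val nu x (some_end w).

(* The conditions at a vertex of degree d are indexed by its d endpoints: at
   one of them the Kirchhoff condition, at the others the continuity. *)
Definition condition D nu z x : R :=
  if attach z \in D then end_val nu x z
  else if z == some_end (attach z) then kirchhoff nu (attach z) x
  else end_val nu x z - vertex_val nu (attach z) x.

Lemma condition_is_linear D nu z : linear (condition D nu z : coords -> R^o).
Proof.
move=> c x y; rewrite /condition /vertex_val.
case: ifP => _; first exact: end_val_is_linear.
case: ifP => _; first exact: kirchhoff_is_linear.
by rewrite !end_val_is_linear [_ *: _]mulrBr; ring.
Qed.

Definition condition_space (P : pred endpoint) D nu : {vspace coords} :=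
  (\bigcap_(z | P z) lker (linfun (condition D nu z : coords -> R^o)))%VS.

Lemma mem_condition_space (P : pred endpoint) D nu x :
  reflect (forall z, P z -> condition D nu z x = 0)
    (x \in condition_space P D nu).
Proof.
rewrite mem_bigcap_lker; apply: (iffP forall_inP) => cx z /cx.
  by rewrite linfun_linear; [move/eqP | exact: condition_is_linear].
by rewrite linfun_linear; [move/eqP | exact: condition_is_linear].
Qed.

(** One condition for each endpoint and two unknowns for each edge: the system is square. *)
Definition eigen D nu := condition_space predT D nu.

Lemma eigenP D nu x : reflect
  [/\ forall z z', attach z = attach z' -> end_val nu x z = end_val nu x z',
      forall z, attach z \in D -> end_val nu x z = 0 &
      forall w, w \notin D -> kirchhoff nu w x = 0]
  (x \in eigen D nu).
Proof.
apply: (iffP (mem_condition_space _ _ _ _)) => [cx|[cont dir kir] z _].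
- have dir z : attach z \in D -> end_val nu x z = 0.
    by move=> zD; have := cx z isT; rewrite /condition zD.
  split => // [z z' zz'|w wD].
    suff H t : end_val nu x t = vertex_val nu (attach t) x by rewrite H [RHS]H zz'.
    have [tD|tD] := boolP (attach t \in D).
      by rewrite /vertex_val !dir // some_endK.
    have := cx t isT; rewrite /condition (negbTE tD).
    have [e|_] := eqVneq t (some_end (attach t)); first by rewrite /vertex_val -e.
    by move/eqP; rewrite subr_eq0 => /eqP.
  have := cx (some_end w) isT.
  by rewrite /condition some_endK (negbTE wD) eqxx.
- rewrite /condition; case: ifPn => [/dir //|zD]; case: eqP => _; first exact: kir.
  by rewrite /vertex_val (cont z (some_end (attach z))) ?subrr // some_endK.
Qed.

(* The index some_end w is that of the Kirchhoff condition at w, which alone is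
   dropped when w is not in D. *)
Definition free_eigen D w nu :=
  condition_space (fun z => z != some_end w) D nu.

Lemma free_eigenP D w nu x : w \notin D -> reflect
  [/\ forall z z', attach z = attach z' -> end_val nu x z = end_val nu x z',
      forall z, attach z \in D -> end_val nu x z = 0 &
      forall w', w' != w -> w' \notin D -> kirchhoff nu w' x = 0]
  (x \in free_eigen D w nu).
Proof.
move=> wD; apply: (iffP (mem_condition_space _ _ _ _)) => [cx|[cont dir kir] z zw].
- have ne z : attach z != w -> z != some_end w.
    by apply: contraNneq => ->; rewrite some_endK.
  have dir z : attach z \in D -> end_val nu x z = 0.
    move=> zD; have := cx z; rewrite /condition zD; apply; apply: ne.
    by apply: contraNneq wD => <-.
  split => // [z z' zz'|w' w'w w'D].
    suff H t : end_val nu x t = vertex_val nu (attach t) x by rewrite H [RHS]H zz'.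
    have [tD|tD] := boolP (attach t \in D).
      by rewrite /vertex_val !dir // some_endK.
    have [e|tne] := eqVneq t (some_end (attach t)); first by rewrite /vertex_val -e.
    have tw : t != some_end w.
      by apply: contraNneq tne => ->; rewrite some_endK.
    have := cx t tw; rewrite /condition (negbTE tD) (negbTE tne).
    by move/eqP; rewrite subr_eq0 => /eqP.
  have := cx (some_end w'); rewrite /condition some_endK (negbTE w'D) eqxx; apply.
  by apply: ne; rewrite some_endK.
- rewrite /condition; case: ifPn => [/dir //|zD]; case: eqP => [ez|_].
    apply: kir => //; apply: contraNneq zw => e; by rewrite ez e.
  by rewrite /vertex_val (cont z (some_end (attach z))) ?subrr // some_endK.
Qed.

Lemma graph_sol_lo nu x e : graph_sol nu x e (lo e) = cdata x (e, false).
Proof. by rewrite /graph_sol subrr /edge_sol usol0. Qed.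

Lemma graph_sol_is_linear nu e t c x y :
  graph_sol nu (c *: x + y) e t = c * graph_sol nu x e t + graph_sol nu y e t.
Proof. exact: edge_sol_is_linear. Qed.

Lemma edge_norm_eq0 nu x e :
  \int[leb]_(t in `[0, edge_length e]) (edge_sol nu x e t ^+ 2) = 0 ->
  cdata x (e, false) = 0 /\ cdata x (e, true) = 0.
Proof. exact/usol_eq0/edge_length_gt0. Qed.

Lemma cdata_eq0 x : (forall e, cdata x (e, false) = 0 /\ cdata x (e, true) = 0) ->
  x = 0.
Proof.
move=> x0; apply/rowP => i; rewrite mxE -(enum_valK i).
by case: (enum_val i) => e []; have [] := x0 e.
Qed.

Lemma graph_sol_eq0 nu x : eq_on_graph (graph_sol nu x) (fun _ _ => 0) -> x = 0.
Proof.
move=> x0; apply: cdata_eq0 => e; apply: (@edge_norm_eq0 nu).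
rewrite (@eq_Rintegral _ _ _ _ _ (cst 0)).
  by rewrite Rintegral_cst //= mul0r.
move=> t; rewrite inE /= in_itv /= => /andP[t0 te].
have := x0 e (t + lo e); rewrite /graph_sol addrK => ->; first by rewrite expr0n.
by rewrite in_itv /= lerDr t0 -lerBrDr.
Qed.

Lemma eigen_in_eigenspace D nu x : x \in eigen D nu ->
  in_eigenspace D nu (graph_sol nu x).
Proof.
case/eigenP => cont dir kir.
have ev z : end_value (graph_sol nu x) z = end_val nu x z.
  case: z => e []; rewrite /end_value /end_val /position /=; first by [].
  exact: graph_sol_lo.
exists (fun e t => dusol nu (cdata x (e, false)) (cdata x (e, true)) (t - lo e)).
exists (fun e t => - nu * graph_sol nu x e t); split; last first.
  by move=> e; apply: aeW => t _; rewrite mulNr opprK.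
split => [e|z z'|z|w wD]; rewrite ?ev; do ?[exact: usol_H2|exact: cont|exact: dir].
rewrite -[RHS](kir w wD); apply: eq_bigr => -[e []] _;
  rewrite /normal_derivative /end_der /position //=.
by rewrite subrr dusol0.
Qed.

(** [H2_solution] determines f on each edge by its value and derivative at the left end, and these
    are the coordinates of x. *)
Lemma in_eigenspace_eigen D nu f : in_eigenspace D nu f ->
  exists2 x, x \in eigen D nu & eq_on_graph f (graph_sol nu x).
Proof.
move=> [f1 [f2 [[fH2 cont dir kir] eqf]]].
pose x : coords := \row_i (let z := enum_val i in
  if z.2 then f1 z.1 (lo z.1) else f z.1 (lo z.1)).
have x0 e : cdata x (e, false) = f e (lo e) by rewrite /cdata mxE enum_rankK.
have x1 e : cdata x (e, true) = f1 e (lo e) by rewrite /cdata mxE enum_rankK.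
have sol e t : t \in `[lo e, hi e] -> f e t = graph_sol nu x e t /\
    f1 e t = dusol nu (cdata x (e, false)) (cdata x (e, true)) (t - lo e).
  move=> te; have := H2_solution (lo_lt_hi e) (fH2 e) (eqf e) te.
  by rewrite /graph_sol /edge_sol x0 x1.
have hie e : hi e \in `[lo e, hi e] by rewrite in_itv /= lexx ltW ?lo_lt_hi.
have ev z : end_value f z = end_val nu x z.
  case: z => e []; rewrite /end_value /end_val /position /= ?x0 //.
  by rewrite (sol _ _ (hie e)).1.
have ed z : normal_derivative f1 z = end_der nu x z.
  case: z => e []; rewrite /normal_derivative /end_der /position /=; last by rewrite x1.
  by rewrite (sol _ _ (hie e)).2.
exists x; last by move=> e t /sol[].
apply/eigenP; split => [z z'|z|w wD]; rewrite -?ev; [exact: cont|exact: dir|].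
by rewrite -[RHS](kir w wD); apply: eq_bigr => z _; rewrite ed.
Qed.

Lemma graph_sol0 nu e t : graph_sol nu 0 e t = 0.
Proof. by rewrite /graph_sol /edge_sol /usol /cdata !mxE !mul0r addr0. Qed.

Lemma graph_sol_sum nu m (c : 'I_m -> R) (X : 'I_m -> coords) e t :
  graph_sol nu (\sum_j c j *: X j) e t = lin_comb c (fun j => graph_sol nu (X j)) e t.
Proof.
rewrite /lin_comb; apply: (big_rec2 (fun x s => graph_sol nu x e t = s)).
  exact: graph_sol0.
by move=> j x s _ <-; rewrite graph_sol_is_linear.
Qed.

Lemma has_multiplicity_dim D nu : has_multiplicity D nu (\dim (eigen D nu)).
Proof.
set E := eigen D nu; exists (fun j => graph_sol nu (vbasis E)`_j); split.
- by move=> j; apply/eigen_in_eigenspace/vbasis_mem/mem_nth; rewrite size_tuple.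
- move=> c c0; apply/freeP; first exact: basis_free (vbasisP E).
  by apply: (@graph_sol_eq0 nu) => e t te; rewrite graph_sol_sum c0.
- move=> f /in_eigenspace_eigen[x xE fx].
  exists (fun j => coord (vbasis E) j x) => e t te.
  by rewrite fx // {1}(coord_vbasis xE) graph_sol_sum.
Qed.

(** From here on multiplicities are dimensions of subspaces of [coords]. Replacing each F j by its
    coordinates turns independence and spanning of functions into those of vectors. *)
Lemma has_multiplicityP D nu m :
  has_multiplicity D nu m <-> m = \dim (eigen D nu).
Proof.
split=> [[F [Feig Ffree Fspan]]|->]; last exact: has_multiplicity_dim.
have [X XE FX] : exists2 X : 'I_m -> coords, forall j, X j \in eigen D nu &
    forall j, eq_on_graph (F j) (graph_sol nu (X j)).
  have H j : exists x, x \in eigen D nu /\ eq_on_graph (F j) (graph_sol nu x).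
    by have [x] := in_eigenspace_eigen (Feig j); exists x.
  by have [X HX] := choice H; exists X => j; have [] := HX j.
have sumX c e t : t \in `[lo e, hi e] ->
    lin_comb c F e t = graph_sol nu (\sum_j c j *: X j) e t.
  by move=> te; rewrite graph_sol_sum; apply: eq_bigr => j _; rewrite FX.
pose XX := [tuple X j | j < m].
have XXE (j : 'I_m) : XX`_j = X j by rewrite -tnth_nth tnth_mktuple.
have freeX : free XX.
  apply/freeP => c; under eq_bigr do rewrite XXE; move=> c0.
  by apply: Ffree => e t te; rewrite sumX // c0 graph_sol0.
have spanX : <<XX>>%VS = eigen D nu.
  apply/eqP; rewrite eqEsubv; apply/andP; split.
    by apply/span_subvP => x /mapP[j _ ->].
  apply/subvP => x xE; have [c fc] := Fspan _ (eigen_in_eigenspace xE).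
  suff -> : x = \sum_j c j *: X j.
    by apply: rpred_sum => j _; apply/rpredZ/memv_span/map_f; rewrite mem_enum.
  apply/eqP; rewrite -subr_eq0; apply/eqP/(@graph_sol_eq0 nu) => e t te.
  by rewrite addrC -scaleN1r graph_sol_is_linear -sumX // fc // mulN1r addNr.
by move: freeX; rewrite /free spanX size_tuple => /eqP.
Qed.

End Coordinates.

(** * Green's identity with one vertex condition released *)

Section FreeVertex.
Variables (R : realType) (G : metric_graph R) (D : {set vertex G}) (w : vertex G).
Hypothesis wD : w \notin D.
Local Notation leb := (@lebesgue_measure R).
Implicit Types (nu : R) (x y : coords G) (e : edge G).

(** The L_2 inner product of two solutions, whose energies may differ. *)
Definition inner nu x nu' y : R :=
  \sum_e \int[leb]_(t in `[0, edge_length e]) (edge_sol nu x e t * edge_sol nu' y e t).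

(** Grouping the endpoints by vertex, continuity factors out the common value and leaves the
    Kirchhoff sum. At a vertex other than w one of the two factors vanishes, by the Dirichlet or the
    Kirchhoff condition. *)
Lemma sum_vertex_val_kirchhoff nu x nu' y :
  x \in free_eigen D w nu -> y \in free_eigen D w nu' ->
  \sum_z end_val nu x z * end_der nu' y z =
  vertex_val nu w x * kirchhoff nu' w y.
Proof.
move=> /(free_eigenP _ _ wD)[cont dir _] /(free_eigenP _ _ wD)[_ _ kir].
rewrite (partition_big (@attach _ G) predT) //= (bigD1 w) //=.
have vK u : \sum_(z | attach z == u) end_val nu x z * end_der nu' y z =
    vertex_val nu u x * kirchhoff nu' u y.
  rewrite /kirchhoff mulr_sumr; apply: eq_bigr => z /eqP zu.
  by rewrite /vertex_val (cont z (some_end u)) // some_endK.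
rewrite vK big1 ?addr0 // => u uw; rewrite vK.
have [uD|uD] := boolP (u \in D); last by rewrite kir ?mulr0.
by rewrite /vertex_val dir ?mul0r // some_endK.
Qed.

Lemma sum_ends (F : edge G * bool -> R) :
  \sum_z F z = \sum_e (F (e, true) + F (e, false)).
Proof.
rewrite (eq_bigr (fun z => F (z.1, z.2))) => [|[e b] _ //].
rewrite -(pair_bigA _ (fun e b => F (e, b))) /=.
by apply: eq_bigr => e _; rewrite big_bool.
Qed.

(** [edge_green] is summed over the edges; the sign of [end_der] at right ends turns the boundary
    terms into sums over endpoints, which [sum_vertex_val_kirchhoff] collapses to w. *)
Lemma green_identity nu x nu' y :
  x \in free_eigen D w nu -> y \in free_eigen D w nu' ->
  (nu - nu') * inner nu x nu' y =
  kirchhoff nu w x * vertex_val nu' w y - vertex_val nu w x * kirchhoff nu' w y.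
Proof.
move=> xW yW; rewrite [X in _ = X - _]mulrC -!sum_vertex_val_kirchhoff // !sum_ends.
rewrite /inner mulr_sumr -sumrB; apply: eq_bigr => e _.
rewrite edge_green ?ltW ?edge_length_gt0 // /end_val /end_der /=.
by rewrite /edge_sol; ring.
Qed.

Lemma energy_identity nu x : x \in free_eigen D w nu ->
  \sum_e \int[leb]_(t in `[0, edge_length e])
     (dusol nu (cdata x (e, false)) (cdata x (e, true)) t ^+ 2)
  - nu * inner nu x nu x = - (vertex_val nu w x * kirchhoff nu w x).
Proof.
move=> xW; rewrite -sum_vertex_val_kirchhoff // sum_ends.
rewrite /inner mulr_sumr -sumrB -sumrN; apply: eq_bigr => e _.
under [X in _ - nu * X]eq_Rintegral do rewrite -expr2.
rewrite edge_energy ?ltW ?edge_length_gt0 // /end_val /end_der /=.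
by rewrite /edge_sol; ring.
Qed.

Lemma inner_ge0 nu x : 0 <= inner nu x nu x.
Proof.
apply: sumr_ge0 => e _; apply: Rintegral_ge0 => t _.
by rewrite -expr2 sqr_ge0.
Qed.

Lemma inner_eq0 nu x : inner nu x nu x = 0 -> x = 0.
Proof.
move=> /eqP; rewrite psumr_eq0 => [/allP x0|e _]; last first.
  by apply: Rintegral_ge0 => t _; rewrite -expr2 sqr_ge0.
apply: cdata_eq0 => e; apply: (@edge_norm_eq0 _ _ nu).
have := x0 e; rewrite mem_index_enum => /(_ isT)/eqP.
by under eq_Rintegral do rewrite -expr2.
Qed.

Lemma inner_gt0 nu x : x != 0 -> 0 < inner nu x nu x.
Proof.
by move=> x0; rewrite lt_def inner_ge0 andbT; apply: contraNneq x0 => /inner_eq0/eqP.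
Qed.

(** For nu < 0 the energy identity has two nonnegative terms on the left, and the hypothesis makes
    their sum zero. *)
Lemma free_eigen_neg nu x : x \in free_eigen D w nu -> nu < 0 ->
  vertex_val nu w x * kirchhoff nu w x = 0 -> x = 0.
Proof.
move=> xW nu_lt0 xx; have := energy_identity xW; rewrite xx oppr0 => e0.
apply: (@inner_eq0 nu); apply/eqP; rewrite eq_le inner_ge0 andbT.
rewrite -(ler_nM2l nu_lt0) mulr0; move/eqP: e0; rewrite subr_eq0 => /eqP <-.
by apply: sumr_ge0 => e _; apply: Rintegral_ge0 => t _; rewrite sqr_ge0.
Qed.

Lemma free_eigen_zero x : x \in free_eigen D w 0 ->
  vertex_val 0 w x * kirchhoff 0 w x <= 0.
Proof.
move=> xW; have := energy_identity xW; rewrite mul0r subr0 => /eqP.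
rewrite -eqr_oppLR => /eqP <-; rewrite oppr_le0.
by apply: sumr_ge0 => e _; apply: Rintegral_ge0 => t _; rewrite sqr_ge0.
Qed.

(** The energy identity at 0 leaves only the integrals of the squared derivatives, so all
    derivatives vanish. *)
Lemma free_eigen_zero_kirchhoff x : x \in free_eigen D w 0 ->
  vertex_val 0 w x = 0 -> kirchhoff 0 w x = 0.
Proof.
move=> xW x0; have := energy_identity xW; rewrite x0 !mul0r subr0 oppr0 => /eqP.
rewrite psumr_eq0 => [/allP H|e _]; last first.
  by apply: Rintegral_ge0 => t _; rewrite sqr_ge0.
have b0 e : cdata x (e, true) = 0.
  suff [] : cdata x (e, true) = 0 /\ (0 : R) = 0 by [].
  (* At energy 0 the derivative is itself a solution, constant with data (b, 0), so [usol_eq0]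
     applies to it. *)
  apply: (@usol_eq0 _ 0 _ _ _ (edge_length_gt0 e)).
  have := H e; rewrite mem_index_enum => /(_ isT)/eqP e0; rewrite -[RHS]e0.
  by apply: eq_Rintegral => t _; rewrite /usol /dusol oppr0 !mul0r addr0 add0r.
rewrite /kirchhoff big1 // => -[e []] _; rewrite /end_der /= b0 //.
by rewrite /dusol !oppr0 !mul0r addr0 oppr0.
Qed.

Lemma mem_eigen_free nu x :
  (x \in eigen D nu) = (x \in free_eigen D w nu) && (kirchhoff nu w x == 0).
Proof.
apply/eigenP/andP => [[cont dir kir]|[/(free_eigenP _ _ wD)[cont dir kir] /eqP kw]].
  by split; [apply/(free_eigenP _ _ wD); split => // u _; exact: kir|rewrite kir].
by split => // u uD; have [->//|uw] := eqVneq u w; exact: kir.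
Qed.

(** When w is the glued vertex, the Dirichlet condition there decouples the pieces: this is how the
    disjoint union enters the comparison. *)
Lemma mem_eigen_dirichlet nu x : (x \in eigen (w |: D)%SET nu) =
  (x \in free_eigen D w nu) && (vertex_val nu w x == 0).
Proof.
apply/eigenP/andP => [[cont dir kir]|[/(free_eigenP _ _ wD)[cont dir kir] /eqP kw]].
  split; last by rewrite /vertex_val dir // some_endK setU11.
  apply/(free_eigenP _ _ wD); split => // [z zD|u uw uD].
    by apply: dir; rewrite in_setU1 zD orbT.
  by apply: kir; rewrite in_setU1 negb_or uw.
split => // [z|u]; rewrite in_setU1.
  case/orP => [/eqP zw|/dir//]; rewrite -[RHS]kw; apply: cont.
  by rewrite some_endK.
by rewrite negb_or => /andP[]; exact: kir.
Qed.

(** The eigenspace is the kernel of one functional on the released space, the Kirchhoff sum at w; in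
    [dim_free_dirichlet] the functional is the value at w. *)
Lemma dim_free_kirchhoff nu : \dim (free_eigen D w nu) =
  (\dim (eigen D nu) +
   `[< exists2 x, x \in free_eigen D w nu & kirchhoff nu w x != 0%R >])%N.
Proof.
have lin : linear (kirchhoff nu w : coords G -> R^o) by exact: kirchhoff_is_linear.
rewrite (dim_lker_functional (linfun (kirchhoff nu w : coords G -> R^o))).
congr (\dim _ + nat_of_bool _)%N.
  apply/vspaceP => x; rewrite memv_cap memv_ker linfun_linear //.
  by rewrite mem_eigen_free.
apply/subvPn/asboolP => -[x xW nz]; exists x => //; move: nz;
  by rewrite memv_ker linfun_linear.
Qed.

Lemma dim_free_dirichlet nu : \dim (free_eigen D w nu) =
  (\dim (eigen (w |: D)%SET nu) +
   `[< exists2 x, x \in free_eigen D w nu & vertex_val nu w x != 0%R >])%N.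
Proof.
have lin : linear (vertex_val nu w : coords G -> R^o).
  by move=> c x y; exact: end_val_is_linear.
rewrite (dim_lker_functional (linfun (vertex_val nu w : coords G -> R^o))).
congr (\dim _ + nat_of_bool _)%N.
  apply/vspaceP => x; rewrite memv_cap memv_ker linfun_linear //.
  by rewrite mem_eigen_dirichlet.
apply/subvPn/asboolP => -[x xW nz]; exists x => //; move: nz;
  by rewrite memv_ker linfun_linear.
Qed.

(** There are as many unknowns as endpoints, and one condition fewer. *)
Lemma dim_free_gt0 nu : (0 < \dim (free_eigen D w nu))%N.
Proof.
have := dim_bigcap_lker (fun z => z != some_end w)
  (fun z => linfun (condition D nu z : coords G -> R^o)) fullv.
have -> : \dim {:coords G} = #|{: edge G * bool}| by rewrite dimvf /dim /= mul1n.
rewrite capfv -/(condition_space (fun z => z != some_end w) D nu).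
rewrite -/(free_eigen D w nu); move: (\dim _) => d.
have -> : #|(fun z => z != some_end w) : pred _| = #|{: edge G * bool}|.-1.
  by rewrite -(cardC1 (some_end w)); apply: eq_card.
have : (0 < #|{: edge G * bool}|)%N by apply/card_gt0P; exists (some_end w).
by case: d => // N_gt0; rewrite add0n -{1}(prednK N_gt0) ltnn.
Qed.

End FreeVertex.

(** * Limits of solutions *)

Section SphereCompactness.
Variable R : realType.

Lemma natSinv_cvg_dist (V : normedModType R) (u : nat -> V) (l : V) :
  (forall n, `|u n - l| < n.+1%:R^-1) -> u n @[n --> \oo] --> l.
Proof.
move=> ul; apply/cvgrPdistC_lt => e e0; near=> n; rewrite (lt_trans (ul n)) //.
by near: n; exact: (near_infty_natSinv_lt (PosNum e0)).
Unshelve. all: by end_near. Qed.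

(** Compactness of the unit sphere in finite dimension; the form of the conclusion lets a
    subsequence be picked term by term. *)
Lemma unit_sequence_cluster N (x : nat -> 'rV[R]_N) : (forall n, `|x n| = 1) ->
  exists2 h, `|h| = 1 &
    forall (e : R) n, 0 < e -> exists2 m, (n <= m)%N & `|x m - h| < e.
Proof.
move=> x1; have cpt : compact [set y : 'rV[R]_N | `|y| = 1].
  apply: bounded_closed_compact.
    by exists 1; split=> // M M1 y /= ->; exact: ltW.
  have -> : [set y : 'rV[R]_N | `|y| = 1] = (fun y => `|y|) @^-1` [set 1] by [].
  apply: preimage_closed => [y _|]; [exact: norm_continuous | exact: closed_eq].
have [|h [h1 xh]] := cpt (x n @[n --> \oo]) _.
  by exists 0%N => // n _ /=; rewrite x1.
exists h => // e n e0.
have hB : nbhs h (ball h e) by apply: nbhsx_ballx.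
have hF : (x n @[n --> \oo]) [set y | exists2 m, (n <= m)%N & x m = y].
  by exists n => // m nm; exists m.
have [y [[m nm <-] hm]] := xh _ _ hF hB.
by exists m => //; rewrite distrC; move: hm; rewrite -ball_normE.
Qed.

End SphereCompactness.

Section Limits.
Variables (R : realType) (G : metric_graph R) (D : {set vertex G}) (w : vertex G).
Hypothesis wD : w \notin D.
Implicit Types (nu : R) (x y h : coords G) (e : edge G).

Section Convergence.
Variables (nu_ : nat -> R) (x_ : nat -> coords G) (nu : R) (h : coords G).
Hypotheses (nu_ge0 : forall n, 0 <= nu_ n) (nu0 : 0 <= nu)
  (cnu : nu_ n @[n --> \oo] --> nu) (cx : x_ n @[n --> \oo] --> h).

Lemma cdata_cvg z : cdata (x_ n) z @[n --> \oo] --> cdata h z.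
Proof. exact: cvg_comp cx (@coord_continuous R _ _ 0 (enum_rank z) h). Qed.

Lemma end_val_cvg z : end_val (nu_ n) (x_ n) z @[n --> \oo] --> end_val nu h z.
Proof.
case: z => e []; rewrite /end_val /=; last exact: cdata_cvg.
by apply: usol_cvg => //; [exact: cdata_cvg.. | exact/ltW/edge_length_gt0].
Qed.

Lemma end_der_cvg z : end_der (nu_ n) (x_ n) z @[n --> \oo] --> end_der nu h z.
Proof.
case: z => e []; rewrite /end_der /=; last exact: cdata_cvg.
apply: cvgN.
by apply: dusol_cvg => //; [exact: cdata_cvg.. | exact/ltW/edge_length_gt0].
Qed.

Lemma vertex_val_cvg u :
  vertex_val (nu_ n) u (x_ n) @[n --> \oo] --> vertex_val nu u h.
Proof. exact: end_val_cvg. Qed.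

Lemma kirchhoff_cvg u :
  kirchhoff (nu_ n) u (x_ n) @[n --> \oo] --> kirchhoff nu u h.
Proof.
rewrite /kirchhoff; apply: cvg_big => [|z _]; last exact: end_der_cvg.
exact: add_continuous.
Qed.

Lemma inner_cvg nu' y :
  inner (nu_ n) (x_ n) nu' y @[n --> \oo] --> inner nu h nu' y.
Proof.
rewrite /inner; apply: cvg_big => [|e _]; first exact: add_continuous.
by apply: usolM_integral_cvg => //; [exact: cdata_cvg.. | exact/ltW/edge_length_gt0].
Qed.

Lemma condition_cvg z :
  condition D (nu_ n) z (x_ n) @[n --> \oo] --> condition D nu z h.
Proof.
rewrite /condition; case: ifP => _; first exact: end_val_cvg.
case: ifP => _; first exact: kirchhoff_cvg.
by apply: cvgB; exact: end_val_cvg.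
Qed.

Lemma free_eigen_cvg : (forall n, x_ n \in free_eigen D w (nu_ n)) ->
  h \in free_eigen D w nu.
Proof.
move=> xW; apply/mem_condition_space => z zw.
have -> : condition D nu z h = lim (condition D (nu_ n) z (x_ n) @[n --> \oo]).
  by apply/esym/cvg_lim; [exact: Rhausdorff | exact: condition_cvg].
apply: cvg_lim; first exact: Rhausdorff.
have -> : (fun n => condition D (nu_ n) z (x_ n)) = cst 0.
  by apply/funext => n; have /mem_condition_space -> := xW n.
exact: cvg_cst.
Qed.

End Convergence.

(* A nonzero limit of solutions at energies tending to nu is orthogonal, by
   Green's identity, to the solutions at nu with vertex_val = kirchhoff = 0. *)
Lemma limit_solution nu (Q : R -> coords G -> Prop) : 0 <= nu ->
  (forall nu' x (c : R), 0 < c -> Q nu' x -> Q nu' (c *: x)) ->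
  (forall eps, 0 < eps -> exists nu' x, [/\ 0 <= nu', nu' != nu,
     `|nu' - nu| < eps, x \in free_eigen D w nu' & x != 0 /\ Q nu' x]) ->
  exists (nu_ : nat -> R) (x_ : nat -> coords G) h,
    [/\ forall n, [/\ 0 <= nu_ n, nu_ n != nu, x_ n \in free_eigen D w (nu_ n)
          & Q (nu_ n) (x_ n)],
        nu_ n @[n --> \oo] --> nu, x_ n @[n --> \oo] --> h,
        h \in free_eigen D w nu &
        h != 0 /\ (vertex_val nu w h != 0) || (kirchhoff nu w h != 0)].
Proof.
move=> nu0 Qscale near_nu.
have [nux H] : exists nux : nat -> R * coords G, forall n,
    [/\ 0 <= (nux n).1, (nux n).1 != nu, `|(nux n).1 - nu| < n.+1%:R^-1,
        (nux n).2 \in free_eigen D w (nux n).1 &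
        `|(nux n).2| = 1 /\ Q (nux n).1 (nux n).2].
  suff /choice[f fP] : forall n, exists p : R * coords G,
      [/\ 0 <= p.1, p.1 != nu, `|p.1 - nu| < n.+1%:R^-1,
        p.2 \in free_eigen D w p.1 & `|p.2| = 1 /\ Q p.1 p.2] by exists f.
  move=> n; have [|nu' [x [? ? ? xW [x0 Qx]]]] := near_nu n.+1%:R^-1.
    by rewrite invr_gt0 ltr0n.
  (* Scaling to the unit sphere keeps the limit nonzero; hence the demand that Q be stable under
     positive factors. *)
  exists (nu', `|x|^-1 *: x); split => //=; first exact: rpredZ.
  split; last by apply: Qscale => //; rewrite invr_gt0 normr_gt0.
  by rewrite normrZ normfV normr_id mulVf // normr_eq0.
have [h h1 hcl] := @unit_sequence_cluster R _ (fun n => (nux n).2)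
  (fun n => let: And5 _ _ _ _ (conj e _) := H n in e).
(* The subsequence: n <= phi n keeps the energies within 1/(n+1) of nu. *)
have /choice[phi phiP] : forall n, exists m,
    (n <= m)%N /\ `|(nux m).2 - h| < n.+1%:R^-1.
  by move=> n; have [|m] := hcl n.+1%:R^-1 n; [rewrite invr_gt0 ltr0n|exists m].
have cnu : (nux (phi n)).1 @[n --> \oo] --> nu.
  apply: natSinv_cvg_dist => n; have [_ _ d _ _] := H (phi n).
  apply: lt_le_trans d _; rewrite lef_pV2 ?posrE ?ltr0n // ler_nat ltnS.
  by have [] := phiP n.
have cx : (nux (phi n)).2 @[n --> \oo] --> h.
  by apply: natSinv_cvg_dist => n; have [] := phiP n.
have n_ge0 n : 0 <= (nux (phi n)).1 by have [] := H (phi n).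
have xW n : (nux (phi n)).2 \in free_eigen D w (nux (phi n)).1.
  by have [] := H (phi n).
have hW := free_eigen_cvg n_ge0 nu0 cnu cx xW.
have h0 : h != 0 by rewrite -normr_eq0 h1 oner_eq0.
exists (fun n => (nux (phi n)).1), (fun n => (nux (phi n)).2), h; split => //.
  by move=> n; have [? ? _ ? [_ ?]] := H (phi n).
split=> //; rewrite -negb_and; apply/negP => /andP[/eqP V0 /eqP K0].
have := inner_gt0 nu h0; rewrite lt_neqAle => /andP[/eqP + _]; apply.
have <- : lim (inner (nux (phi n)).1 (nux (phi n)).2 nu h @[n --> \oo]) =
    inner nu h nu h.
  by apply: cvg_lim; [exact: Rhausdorff | exact: inner_cvg].
apply/esym/cvg_lim; first exact: Rhausdorff.
have -> : (fun n => inner (nux (phi n)).1 (nux (phi n)).2 nu h) = cst 0.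
  apply/funext => n; have := green_identity wD (xW n) hW.
  rewrite V0 K0 !mulr0 subrr => /eqP; rewrite mulf_eq0 subr_eq0.
  by have [_ /negbTE -> _ _ _] := H (phi n); move/eqP.
exact: cvg_cst.
Qed.

End Limits.

(** * Interlacing *)

Section Interlacing.
Variables (R : realType) (G : metric_graph R) (D : {set vertex G}) (w : vertex G).
Hypothesis wD : w \notin D.
Implicit Types (nu t : R) (x y h : coords G).

Local Notation W := (free_eigen D w).
Local Notation val nu x := (vertex_val nu w x).
Local Notation kir nu x := (kirchhoff nu w x).

(* The zeros and poles of the Weyl function kir / val. *)
Definition is_pole nu := exists2 x, x \in W nu & val nu x = 0 /\ kir nu x != 0.
Definition is_zero nu := exists2 x, x \in W nu & kir nu x = 0 /\ val nu x != 0.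
(** The sign of kir / val, written as a product to avoid division; applied with s = 1 and s = -1. *)
Definition has_sign (s : R) nu :=
  exists2 x, x \in W nu & 0 < s * (val nu x * kir nu x).

(** Green's identity at equal energies: the pairs (val, kir) form an isotropic, hence at most
    one-dimensional, subspace of the plane. *)
Lemma free_eigen_lagrangian nu x y : x \in W nu -> y \in W nu ->
  kir nu x * val nu y = val nu x * kir nu y.
Proof.
move=> xW yW; have := green_identity wD xW yW.
by rewrite subrr mul0r => /esym/eqP; rewrite subr_eq0 => /eqP.
Qed.

Lemma val_is_linear nu c x y : val nu (c *: x + y) = c * val nu x + val nu y.
Proof. exact: end_val_is_linear. Qed.

Lemma valZ nu c x : val nu (c *: x) = c * val nu x.
Proof.
have v0 : val nu 0 = 0.
  by have := val_is_linear nu (-1) 0 0; rewrite scaleN1r addNr mulN1r addNr.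
by rewrite -[c *: x]addr0 val_is_linear v0 addr0.
Qed.

Lemma kirZ nu c x : kir nu (c *: x) = c * kir nu x.
Proof.
have k0 : kir nu 0 = 0.
  by have := kirchhoff_is_linear nu w (-1) 0 0; rewrite scaleN1r addNr mulN1r addNr.
by rewrite -[c *: x]addr0 kirchhoff_is_linear k0 addr0.
Qed.

(** A nonzero element of W at nu may have val = kir = 0; a limit of nonzero solutions at energies nu
    + eps / 2 does not, by [limit_solution]. *)
Lemma exists_nondegenerate nu : 0 <= nu ->
  exists2 x, x \in W nu & (val nu x != 0) || (kir nu x != 0).
Proof.
move=> nu0; have [//|eps e0|nu_ [x_ [h [_ _ _ hW [_ hne]]]]] :=
  @limit_solution R G D w wD nu (fun _ _ => True) nu0; last by exists h.
exists (nu + eps / 2), (vpick (W (nu + eps / 2))); split.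
- by rewrite addr_ge0 // divr_ge0 // ltW.
- by rewrite -subr_eq0 addrC addKr gt_eqF // divr_gt0.
- by rewrite addrC addKr gtr0_norm ?divr_gt0 //; lra.
- exact: memv_pick.
- by rewrite vpick0 -dimv_eq0 -lt0n dim_free_gt0.
Qed.

Lemma sign_cases nu : 0 <= nu ->
  [\/ has_sign 1 nu, has_sign (-1) nu, is_zero nu | is_pole nu].
Proof.
move=> /exists_nondegenerate[x xW]; have [v0|v0] /= := eqVneq (val nu x) 0.
  by move=> k0; apply: Or44; exists x.
have [k0|k0] := eqVneq (kir nu x) 0; first by move=> _; apply: Or43; exists x.
have [p|p|p] := ltgtP 0 (val nu x * kir nu x).
- by move=> _; apply: Or41; exists x; rewrite ?mul1r.
- by move=> _; apply: Or42; exists x; rewrite ?mulN1r ?oppr_gt0.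
- by have := mulf_neq0 v0 k0; rewrite -p eqxx.
Qed.

(** The contrapositive of [limit_solution]: to show that solutions at nearby energies avoid Q, it is
    enough to refute Q along a convergent sequence. *)
Lemma near_not nu (Q : R -> coords G -> Prop) : 0 <= nu ->
  (forall nu' x (c : R), 0 < c -> Q nu' x -> Q nu' (c *: x)) ->
  (forall (nu_ : nat -> R) (x_ : nat -> coords G) h,
    (forall n, [/\ 0 <= nu_ n, nu_ n != nu, x_ n \in W (nu_ n) & Q (nu_ n) (x_ n)]) ->
    nu_ n @[n --> \oo] --> nu -> x_ n @[n --> \oo] --> h -> h \in W nu ->
    (val nu h != 0) || (kir nu h != 0) -> h != 0 -> False) ->
  exists2 eps : R, 0 < eps & forall nu' x, 0 <= nu' -> nu' != nu ->
    `|nu' - nu| < eps -> x \in W nu' -> x != 0 -> ~ Q nu' x.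
Proof.
move=> nu0 Qscale absurd; apply: contrapT => no_eps.
have [eps e0|nu_ [x_ [h [H cnu cx hW [h0 hne]]]]] :=
  @limit_solution R G D w wD nu Q nu0 Qscale.
- apply: contrapT => none; apply: no_eps; exists eps => // nu' x h1 h2 h3 h4 h5 q.
  by apply: none; exists nu', x.
- exact: (absurd nu_ x_ h).
Qed.

Lemma nondegenerate_neq0 nu x : (val nu x != 0) || (kir nu x != 0) -> x != 0.
Proof.
apply: contraTneq => ->; rewrite -(scale0r 0) valZ kirZ !mul0r.
by rewrite eqxx.
Qed.

Lemma scale_sign nu c x :
  val nu (c *: x) * kir nu (c *: x) = c ^+ 2 * (val nu x * kir nu x).
Proof. by rewrite valZ kirZ; ring. Qed.

(** By [free_eigen_lagrangian] the pair of x is a multiple of that of y, and the product of val and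
    kir scales by a square. *)
Lemma sign_exclusive s nu x : has_sign s nu -> x \in W nu ->
  (val nu x != 0) || (kir nu x != 0) -> 0 < s * (val nu x * kir nu x).
Proof.
move=> [y yW ypos] xW.
have := free_eigen_lagrangian xW yW.
move: (kir nu x) (val nu x) (kir nu y) (val nu y) ypos => kh vh ky vy yp.
have vy0 : vy != 0 by apply: contraTneq yp => ->; rewrite mul0r mulr0 ltxx.
have [->|vh0 e _] := eqVneq vh 0.
  rewrite mul0r /= => /eqP; rewrite mulf_eq0 (negbTE vy0) orbF => /eqP ->.
  by rewrite eqxx.
have -> : s * (vh * kh) = (vh / vy) ^+ 2 * (s * (vy * ky)).
  by rewrite -[kh](mulfK vy0) e; field.
by rewrite mulr_gt0 // lt_def sqr_ge0 sqrf_eq0 mulf_neq0 // invr_eq0.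
Qed.

(** If nearby solutions failed to have sign s, so would a nondegenerate limit at nu, against
    [sign_exclusive]. *)
Lemma has_sign_near s nu : 0 <= nu -> has_sign s nu ->
  exists2 eps : R, 0 < eps & forall t, 0 <= t -> `|t - nu| < eps -> has_sign s t.
Proof.
move=> nu0 [y yW ypos].
have [||eps e0 H] := @near_not nu (fun t x => s * (val t x * kir t x) <= 0) nu0.
- move=> t x c c0.
  by rewrite scale_sign [s * (c ^+ 2 * _)]mulrCA (pmulr_rle0 _ (exprn_gt0 2 c0)).
- move=> nu_ x_ h H cnu cx hW hne h0.
  have hpos : 0 < s * (val nu h * kir nu h) by apply: sign_exclusive; [exists y|..].
  have cvk : s * (val (nu_ n) (x_ n) * kir (nu_ n) (x_ n)) @[n --> \oo] -->
      s * (val nu h * kir nu h).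
    have n_ge0 n : 0 <= nu_ n by have [] := H n.
    by apply: cvgMr; apply: cvgM; [exact: vertex_val_cvg | exact: kirchhoff_cvg].
  have [N _ /(_ N (leqnn N)) /=] := cvgr_gt _ cvk _ hpos.
  by have [_ _ _] := H N; rewrite leNgt => /negP.
- exists eps => // t t0 te; have [->|tnu] := eqVneq t nu; first by exists y.
  have [x xW xne] := exists_nondegenerate t0.
  exists x => //; rewrite ltNge; apply/negP.
  by apply: H => //; exact: nondegenerate_neq0 xne.
Qed.

(* Green's identity between nearby energies fixes the sign of val * kir on both
   sides of a zero or of a pole. *)
Lemma is_zero_near nu : 0 <= nu -> is_zero nu -> exists2 eps : R, 0 < eps &
  forall t, 0 <= t -> `|t - nu| < eps ->
    (t < nu -> has_sign (-1) t) /\ (nu < t -> has_sign 1 t).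
Proof.
move=> nu0 [y yW [ky0 vy0]].
have [||eps e0 H] :=
  @near_not nu (fun t x => (t - nu) * (val t x * kir t x) <= 0) nu0.
- move=> t x c c0.
  by rewrite scale_sign [_ * (c ^+ 2 * _)]mulrCA (pmulr_rle0 _ (exprn_gt0 2 c0)).
- move=> nu_ x_ h H cnu cx hW hne h0.
  have n_ge0 n : 0 <= nu_ n by have [] := H n.
  have kh0 : kir nu h = 0.
    have := free_eigen_lagrangian hW yW; rewrite ky0 mulr0 => /eqP.
    by rewrite mulf_eq0 (negbTE vy0) orbF => /eqP.
  have vh0 : val nu h != 0 by move: hne; rewrite kh0 eqxx orbF.
  (* As kir h = 0, Green's identity reads (t - nu) inner = kir x val h. Hence (t - nu) val x kir x
     has the sign of inner val x val h, whose limit is positive. *)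
  have lim : inner (nu_ n) (x_ n) nu h * (val (nu_ n) (x_ n) * val nu h)
      @[n --> \oo] --> inner nu h nu h * (val nu h * val nu h).
    apply: cvgM; first exact: inner_cvg.
    by apply: cvgMl; exact: vertex_val_cvg.
  have lim_gt0 : 0 < inner nu h nu h * (val nu h * val nu h).
    by rewrite mulr_gt0 ?inner_gt0 // -expr2 lt_def sqr_ge0 sqrf_eq0 vh0.
  have [N _ /(_ N (leqnn N)) /=] := cvgr_gt _ lim _ lim_gt0.
  have [_ nuN xW QN] := H N; have := green_identity wD xW hW.
  rewrite kh0 mulr0 subr0; move: (inner _ _ _ _) QN nuN => p.
  move: (nu_ N) (val (nu_ N) (x_ N)) (kir (nu_ N) (x_ N)) (val nu h) vh0.
  move=> t v k vh vh0 QN nuN e pgt0.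
  have : 0 < (t - nu) ^+ 2 * (p * (v * vh)).
    by rewrite mulr_gt0 // lt_def sqr_ge0 sqrf_eq0 subr_eq0 nuN.
  have -> : (t - nu) ^+ 2 * (p * (v * vh)) = vh ^+ 2 * ((t - nu) * (v * k)).
    have -> : (t - nu) ^+ 2 * (p * (v * vh)) = (t - nu) * v * vh * ((t - nu) * p).
      by ring.
    by rewrite e; ring.
  by rewrite ltNge mulr_ge0_le0 ?sqr_ge0.
- exists eps => // t t0 te.
  have [x xW xne] := exists_nondegenerate t0; have x0 := nondegenerate_neq0 xne.
  have sgn : t != nu -> 0 < (t - nu) * (val t x * kir t x).
    by move=> tnu; rewrite ltNge; apply/negP; exact: H.
  split=> tnu; exists x => //; rewrite ?mulN1r ?mul1r ?oppr_gt0;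
    move: sgn; rewrite neq_lt tnu ?orbT => /(_ isT).
    by rewrite nmulr_rgt0 // subr_lt0.
  by rewrite pmulr_rgt0 // subr_gt0.
Qed.

Lemma is_pole_near nu : 0 <= nu -> is_pole nu -> exists2 eps : R, 0 < eps &
  forall t, 0 <= t -> `|t - nu| < eps ->
    (t < nu -> has_sign 1 t) /\ (nu < t -> has_sign (-1) t).
Proof.
move=> nu0 [y yW [vy0 ky0]].
have [||eps e0 H] :=
  @near_not nu (fun t x => 0 <= (t - nu) * (val t x * kir t x)) nu0.
- move=> t x c c0.
  by rewrite scale_sign [_ * (c ^+ 2 * _)]mulrCA (pmulr_rge0 _ (exprn_gt0 2 c0)).
- move=> nu_ x_ h H cnu cx hW hne h0.
  have n_ge0 n : 0 <= nu_ n by have [] := H n.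
  have vh0 : val nu h = 0.
    have := free_eigen_lagrangian hW yW; rewrite vy0 mulr0 => /esym/eqP.
    by rewrite mulf_eq0 (negbTE ky0) orbF => /eqP.
  have kh0 : kir nu h != 0 by move: hne; rewrite vh0 eqxx.
  (* Now val h = 0 and (t - nu) inner = - val x kir h, whence the opposite sign. *)
  have lim : inner (nu_ n) (x_ n) nu h * (kir (nu_ n) (x_ n) * kir nu h)
      @[n --> \oo] --> inner nu h nu h * (kir nu h * kir nu h).
    apply: cvgM; first exact: inner_cvg.
    by apply: cvgMl; exact: kirchhoff_cvg.
  have lim_gt0 : 0 < inner nu h nu h * (kir nu h * kir nu h).
    by rewrite mulr_gt0 ?inner_gt0 // -expr2 lt_def sqr_ge0 sqrf_eq0 kh0.
  have [N _ /(_ N (leqnn N)) /=] := cvgr_gt _ lim _ lim_gt0.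
  have [_ nuN xW QN] := H N; have := green_identity wD xW hW.
  rewrite vh0 mulr0 sub0r; move: (inner _ _ _ _) QN nuN => p.
  move: (nu_ N) (val (nu_ N) (x_ N)) (kir (nu_ N) (x_ N)) (kir nu h) kh0.
  move=> t v k kh kh0 QN nuN e pgt0.
  have : 0 < (t - nu) ^+ 2 * (p * (k * kh)).
    by rewrite mulr_gt0 // lt_def sqr_ge0 sqrf_eq0 subr_eq0 nuN.
  have -> : (t - nu) ^+ 2 * (p * (k * kh)) = - (kh ^+ 2 * ((t - nu) * (v * k))).
    have -> : (t - nu) ^+ 2 * (p * (k * kh)) = (t - nu) * k * kh * ((t - nu) * p).
      by ring.
    by rewrite e; ring.
  by rewrite oppr_gt0 ltNge mulr_ge0 ?sqr_ge0.
- exists eps => // t t0 te.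
  have [x xW xne] := exists_nondegenerate t0; have x0 := nondegenerate_neq0 xne.
  have sgn : t != nu -> (t - nu) * (val t x * kir t x) < 0.
    by move=> tnu; rewrite ltNge; apply/negP; exact: H.
  split=> tnu; exists x => //; rewrite ?mulN1r ?mul1r ?oppr_gt0;
    move: sgn; rewrite neq_lt tnu ?orbT => /(_ isT).
    by rewrite nmulr_rlt0 // subr_lt0.
  by rewrite pmulr_rlt0 // subr_gt0.
Qed.

Lemma pos_not_neg nu : has_sign 1 nu -> ~ has_sign (-1) nu.
Proof.
move=> p [x xW]; rewrite mulN1r oppr_gt0 => n.
have := sign_exclusive p xW; rewrite mul1r => /(_ _)/lt_trans-/(_ _ _ n).
rewrite ltxx => H; suff: false by []; apply: H.
by rewrite -negb_and; apply: contraTN n => /andP[/eqP -> _]; rewrite mul0r ltxx.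
Qed.

Lemma pos_not_zero nu : has_sign 1 nu -> ~ is_zero nu.
Proof.
move=> p [x xW [k0 v0]]; have := sign_exclusive p xW.
by rewrite v0 k0 !mulr0 ltxx => /(_ isT).
Qed.

Lemma pos_not_pole nu : has_sign 1 nu -> ~ is_pole nu.
Proof.
move=> p [x xW [v0 k0]]; have := sign_exclusive p xW.
by rewrite k0 orbT v0 mul0r mulr0 ltxx => /(_ isT).
Qed.

Lemma zero_not_pole nu : is_zero nu -> ~ is_pole nu.
Proof.
move=> [x xW [k0 v0]] [y yW [v'0 k'0]]; have := free_eigen_lagrangian xW yW.
rewrite k0 mul0r => /esym/eqP.
by rewrite mulf_eq0 (negbTE v0) (negbTE k'0).
Qed.

(** In [zero_below_pole] this prevents the interval of positivity from including 0. *)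
Lemma not_pos_0 : ~ has_sign 1 0.
Proof. by move=> [x xW]; rewrite mul1r ltNge (free_eigen_zero wD xW). Qed.

Lemma is_zero_ge0 nu : is_zero nu -> 0 <= nu.
Proof.
move=> [x xW [k0 v0]]; rewrite leNgt; apply/negP => nu0.
have x0 : x = 0 by apply: (free_eigen_neg wD xW nu0); rewrite k0 mulr0.
by move: v0; rewrite x0 -(scale0r 0) valZ mul0r eqxx.
Qed.

Lemma is_pole_gt0 nu : is_pole nu -> 0 < nu.
Proof.
move=> [x xW [v0 k0]]; rewrite lt_neqAle; apply/andP; split.
  apply: contraNneq k0 => nu0; move: xW v0; rewrite -nu0 => xW v0.
  by rewrite (free_eigen_zero_kirchhoff wD xW).
rewrite leNgt; apply/negP => nu0.
have x0 : x = 0 by apply: (free_eigen_neg wD xW nu0); rewrite v0 mul0r.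
by move: k0; rewrite x0 -(scale0r 0) kirZ mul0r eqxx.
Qed.

(** Let z be the infimum of the left ends of intervals of positivity ending at p. A positive sign at
    z is excluded at 0 and would otherwise allow a smaller left end; a negative sign or a pole at z
    would give negative signs just to its right. By [sign_cases], z is a zero. *)
Lemma zero_below_pole p : is_pole p ->
  exists z, [/\ z < p, is_zero z & forall t, z < t < p -> has_sign 1 t].
Proof.
move=> pp; have p_gt0 := is_pole_gt0 pp.
have [eps e0 near_p] := is_pole_near (ltW p_gt0) pp.
pose S : set R := [set z | 0 <= z < p /\ forall t, z < t < p -> has_sign 1 t].
(* The maximum with 0 keeps to energies >= 0, where the local lemmas apply. *)
have S0 : S (Num.max 0 (p - eps)).
  split=> [|t]; first by rewrite le_max lexx gt_max p_gt0 ltrBlDr ltrDl.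
  rewrite gt_max -andbA => /and3P[t0 pet tp].
  apply: (near_p t (ltW t0) _).1 => //; rewrite distrC gtr0_norm ?subr_gt0 //.
  by rewrite ltrBlDr addrC -ltrBlDr.
have lbS : lbound S 0 by move=> s [/andP[]].
have infS : has_inf S by split; [exists (Num.max 0 (p - eps)) | exists 0].
pose z := inf S; have z0 : 0 <= z by apply: lb_le_inf => //; case: infS.
have zp : z < p.
  by apply: le_lt_trans (ge_inf _ S0) _; [exists 0 | case: S0 => /andP[]].
have posz t : z < t < p -> has_sign 1 t.
  move=> /andP[zt tp]; have [s [_ Ss] st] := inf_lt infS.1 zt.
  by apply: Ss; rewrite st.
have right_not eps' : 0 < eps' ->
    (forall t, 0 <= t -> `|t - z| < eps' -> z < t -> has_sign (-1) t) -> False.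
  move=> e'0 H; pose t := Num.min (z + eps' / 2) ((z + p) / 2).
  have zt : z < t by rewrite lt_min ltrDl divr_gt0 //=; lra.
  have tp : t < p by rewrite gt_min; apply/orP; right; lra.
  have te : `|t - z| < eps'.
    rewrite gtr0_norm ?subr_gt0 // ltrBlDl gt_min; apply/orP; left; lra.
  apply: (@pos_not_neg t); first by apply: posz; rewrite zt.
  by apply: H => //; apply: le_trans (ltW zt).
exists z; split => //; case: (sign_cases z0) => // [pz|nz|pz].
- have z_gt0 : 0 < z.
    by rewrite lt_neqAle z0 andbT; apply/eqP => e; apply: not_pos_0; rewrite e.
  have [e e_gt0 near_z] := has_sign_near z0 pz.
  suff /(ge_inf (ex_intro _ 0 lbS)) : S (Num.max 0 (z - e)).
    by rewrite -/z leNgt gt_max z_gt0 ltrBlDr ltrDl e_gt0.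
  split=> [|t]; first by rewrite le_max lexx gt_max p_gt0 /= ltrBlDr ltr_wpDr // ltW.
  rewrite gt_max -andbA => /and3P[t0 zet tp].
  have [tz|zt|->//] := ltgtP t z; last by apply: posz; rewrite zt.
  apply: near_z; first exact: ltW.
  by rewrite distrC gtr0_norm ?subr_gt0 // ltrBlDr addrC -ltrBlDr.
- have [e e_gt0 near_z] := has_sign_near z0 nz.
  by case: (right_not e e_gt0) => t t0 te _; exact: near_z.
- have [e e_gt0 near_z] := is_pole_near z0 pz.
  by case: (right_not e e_gt0) => t t0 te; case: (near_z t t0 te).
Qed.

(** The same argument upwards, with a supremum q. The pole p bounds it; positivity at q would force
    q < p and could then be continued past q. *)
Lemma pole_above_zero z p : is_zero z -> is_pole p -> z < p ->
  exists q, [/\ z < q <= p, is_pole q & forall t, z < t < q -> has_sign 1 t].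
Proof.
move=> zz pp zp; have z0 := is_zero_ge0 zz.
have [eps e0 near_z] := is_zero_near z0 zz.
pose S : set R := [set s | z < s <= p /\ forall t, z < t < s -> has_sign 1 t].
have S0 : S (Num.min p (z + eps)).
  split=> [|t]; first by rewrite lt_min zp ltrDl e0 ge_min lexx.
  rewrite lt_min => /and3P[zt tp tze].
  apply: (near_z t (le_trans z0 (ltW zt)) _).2 => //.
  by rewrite gtr0_norm ?subr_gt0 // ltrBlDl.
have ubS : ubound S p by move=> s [/andP[]].
have supS : has_sup S by split; [exists (Num.min p (z + eps)) | exists p].
pose q := sup S.
have qp : q <= p by apply: ge_sup => //; case: supS.
have zq : z < q.
  apply: lt_le_trans (ub_le_sup _ S0); last by exists p.
  by case: S0 => /andP[].
have posq t : z < t < q -> has_sign 1 t.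
  move=> /andP[zt tq]; have [s [_ Ss] st] := sup_gt supS.1 tq.
  by apply: Ss; rewrite zt.
have q0 : 0 <= q by apply: le_trans z0 (ltW zq).
have left_not eps' : 0 < eps' ->
    (forall t, 0 <= t -> `|t - q| < eps' -> t < q -> has_sign (-1) t) -> False.
  move=> e'0 H; pose t := Num.max (q - eps' / 2) ((z + q) / 2).
  have zt : z < t by rewrite lt_max; apply/orP; right; lra.
  have tq : t < q by rewrite gt_max; apply/andP; split; lra.
  have te : `|t - q| < eps'.
    rewrite distrC gtr0_norm ?subr_gt0 // ltrBlDr addrC -ltrBlDr lt_max.
    by apply/orP; left; lra.
  apply: (@pos_not_neg t); first by apply: posq; rewrite zt.
  by apply: H => //; apply: le_trans (ltW zt).
exists q; rewrite zq qp; split => //; case: (sign_cases q0) => // [pq|nq|zq'].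
- have {}qp : q < p.
    by rewrite lt_neqAle qp andbT; apply/eqP => e; case: (pos_not_pole pq); rewrite e.
  have [e e_gt0 near_q] := has_sign_near q0 pq.
  suff /(ub_le_sup (ex_intro _ p ubS)) : S (Num.min p (q + e)).
    by rewrite -/q leNgt lt_min qp ltrDl e_gt0.
  split=> [|t]; first by rewrite lt_min zp /= ge_min lexx andbT ltr_wpDr // ltW.
  rewrite lt_min => /and3P[zt tp tqe].
  have [tq|qt|->//] := ltgtP t q; first by apply: posq; rewrite zt.
  apply: near_q; first exact: le_trans (ltW zt).
  by rewrite gtr0_norm ?subr_gt0 // ltrBlDl.
- have [e e_gt0 near_q] := has_sign_near q0 nq.
  by case: (left_not e e_gt0) => t t0 te _; exact: near_q.
- have [e e_gt0 near_q] := is_zero_near q0 zq'.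
  by case: (left_not e e_gt0) => t t0 te; case: (near_q t t0 te).
Qed.

(** Both dimensions are compared with that of W. If exactly one functional is nonzero on W, nu is a
    pole or a zero; if both are, [free_eigen_lagrangian] keeps the line of pairs off the axes; if
    none is, there is neither pole nor zero. *)
Lemma dim_eigen_relation nu :
  (\dim (eigen D nu) + `[< is_pole nu >] =
   \dim (eigen (w |: D)%SET nu) + `[< is_zero nu >])%N.
Proof.
have := dim_free_dirichlet wD nu; rewrite (dim_free_kirchhoff wD nu).
have [[x xW kx]|nk] := pselect (exists2 x, x \in W nu & kir nu x != 0);
  have [[y yW vy]|nv] := pselect (exists2 x, x \in W nu & val nu x != 0).
- rewrite (asboolT (ex_intro2 _ _ x xW kx)) (asboolT (ex_intro2 _ _ y yW vy)).
  rewrite !asboolF //; first by move/addIn => ->.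
    move=> [z zW [k0 v0]]; have := free_eigen_lagrangian zW xW.
    by rewrite k0 mul0r => /esym/eqP; rewrite mulf_eq0 (negbTE v0) (negbTE kx).
  move=> [z zW [v0 k0]]; have := free_eigen_lagrangian zW yW.
  by rewrite v0 mul0r => /eqP; rewrite mulf_eq0 (negbTE k0) (negbTE vy).
- rewrite (asboolT (ex_intro2 _ _ x xW kx)) (asboolF nv).
  rewrite asboolT; last first.
    by exists x => //; split => //; apply/eqP/negPn/negP => vx; apply: nv; exists x.
  by rewrite asboolF // => -[z zW [_ v0]]; apply: nv; exists z.
- rewrite (asboolF nk) (asboolT (ex_intro2 _ _ y yW vy)).
  rewrite asboolF; last by move=> [z zW [_ k0]]; apply: nk; exists z.
  rewrite asboolT // ; exists y => //; split => //.
  by apply/eqP/negPn/negP => ky; apply: nk; exists y.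
- rewrite (asboolF nk) (asboolF nv) !asboolF // => -[z zW [_ k0]].
    by apply: nv; exists z.
  by apply: nk; exists z.
Qed.

(** The bottom of the branch of positivity ending at the pole p, with dummy value 0 off the poles.
    It maps the poles up to lambda bijectively onto the zeros below lambda, if lambda is a pole. *)
Definition zero_below p : R :=
  if pselect (is_pole p) is left pp then projT1 (cid (zero_below_pole pp)) else 0.

Lemma zero_belowP p : is_pole p -> [/\ zero_below p < p, is_zero (zero_below p) &
  forall t, zero_below p < t < p -> has_sign 1 t].
Proof.
by rewrite /zero_below; case: pselect => // pp _; case: cid.
Qed.

(** Of two distinct poles over the same zero, the smaller would lie in the interval of positivity of
    the larger. *)
Lemma zero_below_inj p p' : is_pole p -> is_pole p' ->
  zero_below p = zero_below p' -> p = p'.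
Proof.
wlog pp' : p p' / p <= p'.
  by move=> H ip ip' e; have [/H->//|/ltW/H->//] := leP p p'.
move=> ip ip' e; move: pp'; rewrite le_eqVlt => /predU1P[//|pp'].
have [zp _ _] := zero_belowP ip; have [_ _ pos] := zero_belowP ip'.
by case: (@pos_not_pole p) => //; apply: pos; rewrite -e zp.
Qed.

(** Take the first pole q above z. If z and [zero_below q] differed, the larger would lie in an
    interval of positivity ending at q. *)
Lemma zero_below_surj z lambda : is_zero z -> is_pole lambda -> z < lambda ->
  exists q, [/\ q <= lambda, is_pole q & zero_below q = z].
Proof.
move=> iz il zl; have [q [/andP[zq ql] iq pos]] := pole_above_zero iz il zl.
exists q; split => //; have [z'q iz' pos'] := zero_belowP iq.
have [z'z|zz'|//] := ltgtP (zero_below q) z.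
  by case: (@pos_not_zero z) => //; apply: pos'; rewrite z'z.
by case: (@pos_not_zero (zero_below q)) => //; apply: pos; rewrite zz'.
Qed.

(** From s0 one copy of each pole below lambda is removed, and every zero below lambda is added
    once. These zeros correspond to the poles up to and including lambda, so the list grows by
    exactly one. *)
Theorem interlacing lambda (s0 : seq R) : is_pole lambda ->
  all (fun nu => nu < lambda) s0 ->
  (forall nu, nu < lambda -> \dim (eigen (w |: D)%SET nu) = count_mem nu s0) ->
  (\dim (eigen D lambda)).+1 = \dim (eigen (w |: D)%SET lambda) /\
  exists s, [/\ sorted (fun x y : R => x <= y) s, all (fun nu => nu < lambda) s,
    size s = (size s0).+1 &
    forall nu, nu < lambda -> \dim (eigen D nu) = count_mem nu s].
Proof.
move=> il s0l cnt0; split.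
  have := dim_eigen_relation lambda; rewrite asboolT // asboolF ?addn0 ?addn1 //.
  by move=> /zero_not_pole.
pose P0 := [seq nu <- undup s0 | `[< is_pole nu >]].
have [s1 ps1] : exists s1, perm_eq s0 (P0 ++ s1).
  have [s1] := perm_to_subseq
    (subseq_trans (filter_subseq (fun nu => `[< is_pole nu >]) _) (undup_subseq s0)).
  by exists s1.
(* By [dim_eigen_relation] a pole has positive multiplicity when w is Dirichlet, so it occurs in
   s0. *)
have P0P nu : nu < lambda -> (nu \in P0) = `[< is_pole nu >].
  move=> nul; rewrite mem_filter mem_undup; case: asboolP => //= inu.
  rewrite -has_pred1 has_count -(cnt0 _ nul).
  have := dim_eigen_relation nu; rewrite asboolT // addn1 asboolF ?addn0.
    by move=> <-.
  by move=> /zero_not_pole.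
have P0pole nu : nu \in P0 -> is_pole nu.
  by rewrite mem_filter => /andP[/asboolP].
have P0l nu : nu \in P0 -> nu < lambda.
  by rewrite mem_filter mem_undup => /andP[_ /(allP s0l)].
pose Z := map zero_below (lambda :: P0).
have poles p : p \in lambda :: P0 -> is_pole p /\ p <= lambda.
  by rewrite inE => /predU1P[->//|/[dup] /P0pole ? /P0l/ltW].
have ZP nu : nu < lambda -> (nu \in Z) = `[< is_zero nu >].
  move=> nul; apply/mapP/asboolP => [[p /poles[ip _] ->]|inu].
    by case: (zero_belowP ip).
  have [q [ql iq <-]] := zero_below_surj inu il nul.
  exists q => //; rewrite inE; move: ql; rewrite le_eqVlt => /predU1P[->|ql].
    by rewrite eqxx.
  by rewrite P0P // asboolT // orbT.
have Zuniq : uniq Z.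
  rewrite map_inj_in_uniq => [|p p' /poles[ip _] /poles[ip' _]]; last first.
    exact: zero_below_inj.
  rewrite /= filter_uniq ?undup_uniq // andbT.
  by apply/negP => /P0l; rewrite ltxx.
exists (sort (fun x y : R => x <= y) (Z ++ s1)); split.
- by apply: sort_sorted => x y; exact: le_total.
- rewrite all_sort all_cat; apply/andP; split.
    apply/allP => _ /mapP[p /poles[ip pl] ->].
    by case: (zero_belowP ip) => zp _ _; exact: lt_le_trans pl.
  by move: s0l; rewrite (perm_all _ ps1) all_cat => /andP[].
- by rewrite size_sort size_cat (perm_size ps1) size_cat size_map /= addSn.
move=> nu nul; rewrite count_sort count_cat (count_uniq_mem _ Zuniq) ZP //.
have := dim_eigen_relation nu; rewrite cnt0 // (permP ps1) count_cat.
rewrite (count_uniq_mem _ (filter_uniq _ (undup_uniq s0))) P0P // => e.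
by apply/eqP; rewrite -(eqn_add2r `[< is_pole nu >]) e; apply/eqP; lia.
Qed.

End Interlacing.

(** * The glued graph *)

Section GluedGraph.
Variables (R : realType) (p : nat) (p_gt1 : (1 < p)%N).
Variables (G : 'I_p -> metric_graph R) (v : forall i, vertex (G i)).
Variable D : forall i : 'I_p, {set vertex (G i)}.
Hypothesis v_in_D : forall i, v i \in D i.

Local Notation GG := (Defs.glue p_gt1 v).
Local Notation DD := (glue_dirichlet p_gt1 v D).
Local Notation DD0 := ((None : vertex GG) |: (DD : {set vertex GG}))%SET.
Local Notation proj := (glue_proj v).
Local Notation tage e := (Tagged (fun i => edge (G i)) e).
Local Notation tagv u := (Tagged (fun i => vertex (G i)) u).

Definition glue_end i (z : edge (G i) * bool) : edge GG * bool :=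
  (tage z.1, z.2).

Lemma glue_attach_end i (z : edge (G i) * bool) :
  glue_attach v (glue_end z) = proj (attach z).
Proof. by case: z. Qed.

Lemma attach_glue_end i (z : edge (G i) * bool) :
  attach (glue_end z) = proj (attach z) :> vertex GG.
Proof. exact: glue_attach_end. Qed.

Lemma proj_Some i (u : vertex (G i)) (uv : unglued v (tagv u)) :
  proj u = Some (Sub (tagv u) uv).
Proof. by rewrite /glue_proj insubT. Qed.

Lemma proj_eq_None i (u : vertex (G i)) : (proj u == None) = (u == v i).
Proof.
rewrite /glue_proj; case: insubP => [s us|]; last by rewrite negbK => /= ->.
by move: us; rewrite /unglued /= => /negbTE ->.
Qed.

Lemma proj_v i : proj (v i) = None.
Proof. by apply/eqP; rewrite proj_eq_None. Qed.

Lemma proj_inj_tagged i j (u : vertex (G i)) (u' : vertex (G j)) : u != v i ->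
  (proj u == proj u') = (tagv u == tagv u').
Proof.
move=> uv; have [e|ne] := eqVneq u' (v j).
  rewrite {1}e proj_v proj_eq_None (negbTE uv); apply/esym/negbTE.
  apply: contraNneq uv => uu'; have : unglued v (tagv u) = unglued v (tagv u').
    by rewrite uu'.
  by rewrite /unglued /= e eqxx /= => /negbFE.
rewrite (proj_Some (u := u) uv) (proj_Some (u := u') ne).
by apply/eqP/eqP => [/Some_inj/(congr1 val)//|e]; congr Some; apply: val_inj.
Qed.

Lemma proj_inj i (u u' : vertex (G i)) : u != v i -> (proj u == proj u') = (u == u').
Proof. by move=> uv; rewrite proj_inj_tagged // eq_Tagged. Qed.

Lemma proj_tag i j (u : vertex (G i)) (u' : vertex (G j)) : u != v i ->
  proj u = proj u' -> i = j.
Proof. by move=> uv /eqP; rewrite proj_inj_tagged // => /eqP /(congr1 tag). Qed.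

Lemma mem_glue_dirichlet i (u : vertex (G i)) :
  (proj u \in DD) = (u != v i) && (u \in D i).
Proof.
rewrite inE /glue_proj; case: insubP => [s us es|]; last by rewrite negbK => /= ->.
by rewrite es /=; move: us; rewrite /unglued /= => ->.
Qed.

Lemma None_notin_dirichlet : (None : vertex GG) \notin DD.
Proof. by rewrite inE. Qed.

Lemma glue_vertexP (P : vertex GG -> Prop) : P None ->
  (forall i (u : vertex (G i)), u != v i -> P (proj u)) -> forall g, P g.
Proof.
move=> PN PS [[[i u] uv]|//]; have := PS i u uv.
by rewrite (proj_Some uv).
Qed.

Section BigOp.
Variables (T : Type) (idx : T) (op : Monoid.com_law idx).

Lemma big_glue_end (P : pred (edge GG * bool)) (F : edge GG * bool -> T) :
  \big[op/idx]_(z | P z) F z =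
  \big[op/idx]_i \big[op/idx]_(z : edge (G i) * bool | P (glue_end z)) F (glue_end z).
Proof.
have pairE (I : finType) (Q : pred (I * bool)) (H : I * bool -> T) :
    \big[op/idx]_(z | Q z) H z = \big[op/idx]_e \big[op/idx]_(b | Q (e, b)) H (e, b).
  rewrite (pair_big_dep predT (fun e b => Q (e, b)) (fun e b => H (e, b))) /=.
  by apply: eq_big => -[].
rewrite pairE; under [RHS]eq_bigr do rewrite pairE.
rewrite (sig_big_dep predT (fun _ => predT)
  (fun i e => \big[op/idx]_(b | P (glue_end (e, b))) F (glue_end (e, b)))) /=.
by apply: eq_bigr => -[].
Qed.

Lemma big_glue_edge (F : edge GG -> T) : \big[op/idx]_e F e =
  \big[op/idx]_i \big[op/idx]_(e : edge (G i)) F (tage e).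
Proof.
by rewrite (sig_big_dep predT (fun _ => predT)
  (fun i e => F (tage e))); apply: eq_bigr => -[].
Qed.

Lemma big_glue_vertex (F : vertex GG -> T) : \big[op/idx]_g F g =
  op (F None) (\big[op/idx]_i \big[op/idx]_(u : vertex (G i) | u != v i) F (proj u)).
Proof.
rewrite (bigD1 None) //=; congr (op _ _).
pose i0 : 'I_p := Ordinal (ltnW p_gt1).
(* A section of the projection away from the glued vertex; [None] has been split off and gets a
   dummy value. *)
pose h' (g : vertex GG) : {i & vertex (G i)} :=
  if g is Some s then val s else tagv (v i0).
rewrite (reindex_onto (fun u : {i & vertex (G i)} => proj (tagged u)) h').
  rewrite (sig_big_dep predT (fun i u => u != v i) (fun i u => F (proj u))).
  apply: eq_bigl => -[i u] /=; rewrite proj_eq_None.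
  case: (boolP (u == v i)) => //= uv.
  by rewrite (proj_Some (u := u) uv) /= eqxx.
move=> [[[i u] uv]|//] _ /=; exact: proj_Some.
Qed.

End BigOp.

Definition restrict i (x : coords GG) : coords (G i) :=
  \row_k cdata x (glue_end (enum_val k)).

(** Extension by zero to the edges of the other graphs. *)
Definition embed i (y : coords (G i)) : coords GG :=
  \row_k let z := enum_val k in untag 0 (fun e => cdata y (e, z.2)) z.1.

Lemma cdata_restrict i x (z : edge (G i) * bool) :
  cdata (restrict i x) z = cdata x (glue_end z).
Proof. by rewrite {1}/cdata mxE enum_rankK. Qed.

Lemma cdata_embed i (y : coords (G i)) (z : edge (G i) * bool) :
  cdata (embed y) (glue_end z) = cdata y z.
Proof.
rewrite {1}/cdata mxE enum_rankK /= (untagE (u := tage z.1) _ _ (erefl i)).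
by case: z.
Qed.

Lemma cdata_embed_neq i j (y : coords (G i)) (z : edge (G j) * bool) : j != i ->
  cdata (embed y) (glue_end z) = 0.
Proof. by move=> ji; rewrite {1}/cdata mxE enum_rankK /= untag_dflt. Qed.

Lemma cdata_inj (H : metric_graph R) (x y : coords H) : cdata x =1 cdata y -> x = y.
Proof.
move=> xy; apply/rowP => k; have := xy (enum_val k).
by rewrite /cdata enum_valK.
Qed.

Lemma glue_cdata_inj (x y : coords GG) :
  (forall i, restrict i x = restrict i y) -> x = y.
Proof.
move=> xy; apply: cdata_inj => -[[i e] b].
by have := congr1 (fun y => cdata y (e, b)) (xy i); rewrite !cdata_restrict.
Qed.

Lemma restrict_is_linear i : linear (@restrict i).
Proof. by move=> c x y; apply/rowP => k; rewrite !mxE cdata_is_linear. Qed.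

Lemma embed_is_linear i : linear (@embed i).
Proof.
move=> c x y; apply: cdata_inj => -[[j e] b].
rewrite cdata_is_linear -[(existT _ j e, b)]/(glue_end (e, b)).
have [ij|ne] := eqVneq j i; last by rewrite !cdata_embed_neq // mulr0 addr0.
by subst j; rewrite !cdata_embed cdata_is_linear.
Qed.

Lemma restrict_embed i (y : coords (G i)) : restrict i (embed y) = y.
Proof. by apply: cdata_inj => z; rewrite cdata_restrict cdata_embed. Qed.

Lemma restrict_embed_neq i j (y : coords (G i)) : j != i -> restrict j (embed y) = 0.
Proof.
move=> ji; apply: cdata_inj => z; rewrite cdata_restrict cdata_embed_neq //.
by rewrite /cdata mxE.
Qed.

Lemma restrict0 i : restrict i 0 = 0.
Proof. by apply: cdata_inj => z; rewrite cdata_restrict /cdata !mxE. Qed.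

Lemma embed0 i : embed (0 : coords (G i)) = 0.
Proof.
by have := embed_is_linear (-1) (0 : coords (G i)) 0; rewrite !scaleN1r !addNr.
Qed.

Lemma restrict_sum i (X : forall j, coords (G j)) :
  restrict i (\sum_j embed (X j)) = X i.
Proof.
have rD (x y : coords GG) : restrict i (x + y) = restrict i x + restrict i y.
  by rewrite -{1}[x]scale1r restrict_is_linear scale1r.
rewrite (big_morph _ rD (restrict0 i)) (bigD1 i) //= restrict_embed big1 ?addr0 //.
by move=> j ji; rewrite restrict_embed_neq // eq_sym.
Qed.

Lemma sum_restrict (x : coords GG) : x = \sum_j embed (restrict j x).
Proof. by apply: glue_cdata_inj => i; rewrite restrict_sum. Qed.

Lemma end_val_glue nu i (x : coords GG) (z : edge (G i) * bool) :
  end_val nu x (glue_end z) = end_val nu (restrict i x) z.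
Proof. by case: z => e []; rewrite /end_val /edge_sol /= !cdata_restrict. Qed.

Lemma end_der_glue nu i (x : coords GG) (z : edge (G i) * bool) :
  end_der nu x (glue_end z) = end_der nu (restrict i x) z.
Proof. by case: z => e []; rewrite /end_der /= !cdata_restrict. Qed.

Lemma kirchhoff_proj nu i (u : vertex (G i)) (x : coords GG) : u != v i ->
  kirchhoff nu (proj u : vertex GG) x = kirchhoff nu u (restrict i x).
Proof.
move=> uv; rewrite /kirchhoff big_glue_end (bigD1 i) //= [X in _ + X]big1 ?addr0.
  apply: eq_big => [z|z _]; last exact: end_der_glue.
  by rewrite glue_attach_end eq_sym proj_inj // eq_sym.
move=> j ji; apply: big1 => z; rewrite glue_attach_end => /eqP/esym/(proj_tag uv) ij.
by rewrite ij eqxx in ji.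
Qed.

Lemma kirchhoff_None nu (x : coords GG) :
  kirchhoff nu (None : vertex GG) x = \sum_i kirchhoff nu (v i) (restrict i x).
Proof.
rewrite /kirchhoff big_glue_end; apply: eq_bigr => i _.
apply: eq_big => [z|z _]; last exact: end_der_glue.
by rewrite attach_glue_end proj_eq_None.
Qed.

(** With the Dirichlet condition at the glued vertex the pieces no longer interact, and every v i is
    Dirichlet in its own piece. *)
Lemma mem_eigen_glue nu (x : coords GG) :
  reflect (forall i, restrict i x \in eigen (D i) nu)
    (x \in eigen DD0 nu).
Proof.
have projD i (u : vertex (G i)) : (proj u \in DD0) = (u \in D i).
  rewrite in_setU1 mem_glue_dirichlet proj_eq_None.
  by case: eqVneq => [->|] //=; rewrite v_in_D.
apply: (iffP (eigenP _ _ _)) => [[cont dir kir] i|xE].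
- apply/eigenP; split => [z z' zz'|z zD|u uD].
  + by rewrite -!end_val_glue; apply: cont; rewrite !attach_glue_end zz'.
  + by rewrite -end_val_glue; apply: dir; rewrite attach_glue_end projD.
  + rewrite -kirchhoff_proj; first by apply: kir; rewrite projD.
    by apply: contraNneq uD => ->.
- have dir i (z : edge (G i) * bool) : attach z \in D i -> end_val nu x (glue_end z) = 0.
    by move=> zD; rewrite end_val_glue; have /eigenP[_ d _] := xE i; exact: d.
  split => [[[i e] b] [[j e'] b']|[[i e] b]|].
  + rewrite -[(existT _ i e, b)]/(glue_end (e, b)).
    rewrite -[(existT _ j e', b')]/(glue_end (e', b')).
    rewrite !attach_glue_end; set u := attach _; set u' := attach _.
    (* Only at the glued vertex can endpoints of distinct pieces meet, and there all values are
       zero. *)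
    have [uv|uv] := eqVneq u (v i).
      rewrite uv proj_v => /esym/eqP; rewrite proj_eq_None => /eqP u'v.
      by rewrite !dir // -/u -/u' ?uv ?u'v v_in_D.
    move=> uu'; have ij := proj_tag uv uu'; subst j.
    move/eqP: uu'; rewrite proj_inj // => /eqP uu'.
    by rewrite !end_val_glue; have /eigenP[c _ _] := xE i; exact: c.
  + rewrite -[(existT _ i e, b)]/(glue_end (e, b)) attach_glue_end projD; exact: dir.
  + apply: glue_vertexP => [|i u uv]; first by rewrite setU11.
    rewrite projD => uD; rewrite kirchhoff_proj //.
    by have /eigenP[_ _ k] := xE i; exact: k.
Qed.

(** The eigenspace is the direct sum of the images under the maps [embed], which are injective with
    left inverse [restrict]. *)
Lemma dim_eigen_glue nu :
  \dim (eigen DD0 nu) = (\sum_i \dim (eigen (D i) nu))%N.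
Proof.
pose E i := (linfun (@embed i) @: eigen (D i) nu)%VS.
have embE i : linfun (@embed i) =1 @embed i by exact/linfun_linear/embed_is_linear.
have memE i x : reflect (exists2 y, y \in eigen (D i) nu & x = embed y) (x \in E i).
  by apply: (iffP memv_imgP) => -[y yE ->]; exists y; rewrite ?embE.
have -> : eigen DD0 nu = (\sum_i E i)%VS.
  apply/vspaceP => x; apply/mem_eigen_glue/memv_sumP => [xE|[us usE ->] i].
    exists (fun i => embed (restrict i x)) => [i _|]; last exact: sum_restrict.
    by apply/memE; exists (restrict i x); first exact: xE.
  have H j : exists y, y \in eigen (D j) nu /\ us j = embed y.
    by have /memE[y] := usE j isT; exists y.
  have yE j : restrict j (us j) \in eigen (D j) nu /\ us j = embed (restrict j (us j)).
    by have [y [yE ->]] := H j; rewrite restrict_embed.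
  rewrite (eq_bigr _ (fun j _ => (yE j).2)) (restrict_sum i (fun j => restrict j (us j))).
  exact: (yE i).1.
have dir : directv (\sum_i E i).
  apply/directv_sum_independent => us usE us0 i _.
  have /memE[y _ uy] := usE i isT; rewrite uy.
  have yE j : us j = embed (restrict j (us j)).
    have /memE[z _ ->] := usE j isT; by rewrite restrict_embed.
  have := restrict_sum i (fun j => restrict j (us j)).
  have <- : \sum_j us j = \sum_j embed (restrict j (us j)).
    by apply: eq_bigr => j _; exact: yE.
  rewrite us0 restrict0 uy restrict_embed => <-; exact: embed0.
rewrite (directvP dir) /=; apply: eq_bigr => i _; apply: limg_dim_eq.
apply/eqP; rewrite -subv0; apply/subvP => y; rewrite memv_cap memv_ker embE memv0.
by case/andP => _ /eqP y0; rewrite -(restrict_embed y) y0 restrict0.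
Qed.

Lemma total_length_glue : total_length GG = \sum_i total_length (G i).
Proof. by rewrite /total_length big_glue_edge. Qed.

Lemma card_vertex_glue : #|vertex GG| = (\sum_i #|vertex (G i)|.-1).+1.
Proof.
rewrite -sum1_card big_glue_vertex /= add1n; congr _.+1; apply: eq_bigr => i _.
by rewrite sum1_card -(cardC1 (v i)).
Qed.

(** Gluing loses p - 1 vertices, which matches the p constants 1 on the right against a single one
    on the left. *)
Lemma betti_glue : betti GG = \sum_i betti (G i).
Proof.
rewrite /betti; have -> : #|edge GG| = (\sum_i #|edge (G i)|)%N.
  by rewrite -sum1_card big_glue_edge; apply: eq_bigr => i _; rewrite sum1_card.
rewrite card_vertex_glue -addn1 !PoszD opprD addrA subrK.
rewrite !(big_morph Posz PoszD (erefl (Posz 0))) -sumrB; apply: eq_bigr => i _.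
have : (0 < #|vertex (G i)|)%N by apply/card_gt0P; exists (v i).
by lia.
Qed.

Lemma nb_dirichlet_glue : (nb_dirichlet DD + p)%N = (\sum_i nb_dirichlet (D i))%N.
Proof.
rewrite /nb_dirichlet -sum1_card big_mkcond big_glue_vertex /=.
rewrite (negbTE None_notin_dirichlet) add0n.
rewrite -[X in (_ + X)%N]card_ord -sum1_card -big_split /=; apply: eq_bigr => i _.
rewrite (cardD1 (v i)) v_in_D addnC; congr addn.
rewrite -sum1_card big_mkcond [RHS]big_mkcond; apply: eq_bigr => u _.
by rewrite mem_glue_dirichlet !inE; case: (u != v i).
Qed.

Lemma degree_proj i (u : vertex (G i)) : u != v i ->
  degree (proj u : vertex GG) = degree u.
Proof.
move=> uv; rewrite /degree -!sum1dep_card big_glue_end (bigD1 i) //=.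
rewrite [X in addn _ X]big1 ?addn0.
  by apply: eq_bigl => z; rewrite glue_attach_end eq_sym proj_inj // eq_sym.
move=> j ji; apply: big1 => z; rewrite glue_attach_end => /eqP/esym/(proj_tag uv) ij.
by rewrite ij eqxx in ji.
Qed.

Lemma degree_None : degree (None : vertex GG) = (\sum_i degree (v i))%N.
Proof.
rewrite /degree -!sum1dep_card big_glue_end; apply: eq_bigr => i _.
rewrite -sum1dep_card; apply: eq_bigl => z.
by rewrite attach_glue_end proj_eq_None.
Qed.

(** The glued vertex has degree p >= 2 and is not pendant; the v i, being Dirichlet, are not counted
    on the right either. *)
Lemma nb_neumann_glue : (forall i, D i \subset pendant (G i)) ->
  nb_neumann DD = (\sum_i nb_neumann (D i))%N.
Proof.
move=> Dp; rewrite /nb_neumann -sum1_card big_mkcond big_glue_vertex /=.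
have deg1 i : degree (v i) = 1%N.
  by have := fintype.subsetP (Dp i) _ (v_in_D i); rewrite inE => /eqP.
have pN : (None : vertex GG) \notin pendant GG.
  by rewrite inE degree_None (eq_bigr (fun=> 1%N)) // sum1_card card_ord gtn_eqF.
rewrite finset.in_setD (negbTE pN) andbF add0n; apply: eq_bigr => i _.
rewrite -sum1_card [RHS]big_mkcond [RHS](bigD1 (v i)) //= finset.in_setD v_in_D add0n.
by apply: eq_bigr => u uv; rewrite !finset.in_setD mem_glue_dirichlet uv !inE degree_proj.
Qed.

End GluedGraph.

(** * Multiplicity bound *)

Section Propagation.
Variables (R : realType) (G : metric_graph R) (v : vertex G).
Hypothesis conn : connected_graph G.
Local Notation endpoint := (edge G * bool)%type.
Implicit Types (A : {set vertex G}) (u w : vertex G) (e : edge G) (z : endpoint)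
  (nu : R) (x : coords G).

Definition touches A e : bool := (attach (e, false) \in A) || (attach (e, true) \in A).

(** Otherwise A would be closed under adjacency and, by connectedness, contain every vertex. *)
Lemma leaving_edge A : v \in A -> A != [set: vertex G]%SET ->
  exists e b, attach (e, b) \in A /\ attach (e, ~~ b) \notin A.
Proof.
move=> vA AT; apply: contrapT => none.
have closedA u w : Defs.adjacent u w -> u \in A -> w \in A.
  case/existsP => e /existsP[b /andP[/eqP <- /eqP <-]] uA.
  by apply/negPn/negP => wA; apply: none; exists e, b.
case/negP: AT; rewrite finset.eqEsubset finset.subsetT /=; apply/fintype.subsetP => w _.
have /connectP[s + ->] := conn v w; elim: s v vA => //= u s IH t tA /andP[tu].
exact: IH (closedA _ _ tu tA).
Qed.

(** Induction on the size of the complement: by [leaving_edge] a proper set containing v can be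
    enlarged by a neighbour. *)
Lemma growth_ind (P : {set vertex G} -> Prop) : P [set: vertex G]%SET ->
  (forall A e b, v \in A -> attach (e, b) \in A -> attach (e, ~~ b) \notin A ->
     P (attach (e, ~~ b) |: A)%SET -> P A) ->
  forall A, v \in A -> P A.
Proof.
move=> PT Pgrow A; have [n] := ubnP #|~: A|%SET; elim: n A => // n IH A cA vA.
have [->//|AT] := eqVneq A [set: vertex G]%SET.
have [e [b [eA enA]]] := leaving_edge vA AT.
apply: (Pgrow A e b) => //; apply: IH; last by rewrite in_setU1 vA orbT.
rewrite -ltnS (leq_trans _ cA) // ltnS; apply: proper_card.
apply/fintype.properP; split.
  by rewrite finset.setCS finset.subsetUr.
by exists (attach (e, ~~ b)); rewrite !finset.inE ?eqxx.
Qed.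

(** The spanning tree count: each vertex added to A brings at least one new edge with both ends in
    A. *)
Lemma betti_ge0 : 0 <= betti G.
Proof.
suff : (#|~: [set v]%SET| <= #|edge G|)%N.
  by rewrite finset.cardsC1 /betti; have : (0 < #|vertex G|)%N;
    [apply/card_gt0P; exists v | lia].
pose inside A := [set e : edge G |
  (attach (e, false) \in A) && (attach (e, true) \in A)]%SET.
suff H A : v \in A -> (#|~: A| <= #|~: inside A|)%N.
  by rewrite (leq_trans (H _ (finset.set11 v))) // max_card.
move: A; apply: growth_ind => [|A e b vA eA enA le].
  by rewrite finset.setCT finset.cards0.
set w := attach (e, ~~ b) in enA le.
have wnA : w \in (~: A)%SET by rewrite finset.inE.
have einA : e \in (~: inside A)%SET.
  by rewrite !finset.inE; move: enA; rewrite /w; case: b {eA w wnA le} => /negbTE -> //;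
    rewrite andbF.
rewrite (cardsD1 w) wnA (cardsD1 e) einA !add1n ltnS.
have -> : (~: A :\ w = ~: (w |: A))%SET.
  by apply/setP => u; rewrite !finset.inE negb_or.
apply: leq_trans le _; apply: subset_leq_card; apply/fintype.subsetP => e'.
rewrite !finset.inE => ne; apply/andP; split.
  apply: contraNneq ne => ->; move: eA; rewrite /w; case: b {enA w wnA} => /= ->;
    by rewrite eqxx ?orbT.
by apply: contraNN ne => /andP[-> ->]; rewrite !orbT.
Qed.

Lemma degree_gt0 w : (0 < degree w)%N.
Proof. by apply/card_gt0P; exists (some_end w); rewrite finset.inE some_endK. Qed.

Lemma sum_degree : (\sum_(w : vertex G) degree w = 2 * #|edge G|)%N.
Proof.
transitivity (\sum_(z : endpoint) 1)%N; last first.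
  by rewrite sum1_card card_prod card_bool mulnC.
rewrite (partition_big (@attach _ G) predT) //=; apply: eq_bigr => w _.
by rewrite sum1dep_card.
Qed.

(** Degrees are positive, so truncating degree w - 2 adds 1 exactly at pendant vertices; the rest is
    the handshake formula. In terms of beta the sum is P + 2 beta - 2. *)
Lemma sum_excess : (\sum_(w : vertex G) (degree w - 2) + 2 * #|vertex G| =
  2 * #|edge G| + #|pendant G|)%N.
Proof.
rewrite -sum_degree -[#|vertex G|]sum1_card big_distrr -big_split /=.
rewrite -[#|pendant G|]sum1dep_card [X in (_ + X)%N]big_mkcond -big_split /=.
by apply: eq_bigr => w _; have := degree_gt0 w; case: eqP; lia.
Qed.

Section Eigenfunctions.
Variable D : {set vertex G}.
Hypothesis Dp : D \subset pendant G.

Definition eigen_vanishing A nu : {vspace coords G} :=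
  (eigen D nu :&: \bigcap_(z : endpoint | touches A z.1)
    lker (linfun (fun x : coords G => cdata x z : R^o)))%VS.

Lemma eigen_vanishingP A nu x : reflect
  (x \in eigen D nu /\ forall e b, touches A e -> cdata x (e, b) = 0)
  (x \in eigen_vanishing A nu).
Proof.
have lin z : linear (fun x : coords G => cdata x z : R^o).
  by move=> c y y'; exact: cdata_is_linear.
rewrite memv_cap [X in _ && X]mem_bigcap_lker; apply: (iffP andP) => -[xE H]; split => //.
  move=> e b tA; move/forall_inP: H => /(_ (e, b) tA).
  by rewrite linfun_linear // => /eqP.
by apply/forall_inP => -[e b] tA; rewrite linfun_linear //; apply/eqP/H.
Qed.

Lemma end_vanishing nu x z :
  end_val nu x z = 0 -> end_der nu x z = 0 -> forall b, cdata x (z.1, b) = 0.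
Proof.
case: z => e []; rewrite /end_val /end_der /= => val0; last by move=> der0 [].
by move/eqP; rewrite oppr_eq0 => /eqP der0; have [a0 b0] := cauchy_eq0 val0 der0; case.
Qed.

Lemma vanishing_end nu x z : (forall b, cdata x (z.1, b) = 0) ->
  end_val nu x z = 0 /\ end_der nu x z = 0.
Proof.
move=> x0; rewrite /end_val /end_der /edge_sol /usol /dusol !x0.
by rewrite !mulr0 !mul0r addr0 oppr0; case: z.2.
Qed.

(* An edge with zero data at a new vertex w forces the value 0 at w; by the
   Kirchhoff condition it is enough to kill degree w - 2 further derivatives at w
   (none at all when degree w = 1, whence the truncated subtraction). *)
Lemma dim_eigen_vanishing nu A : v \in A ->
  (\dim (eigen_vanishing A nu) <= \sum_(w | w \notin A) (degree w - 2))%N.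
Proof.
move: A; apply: growth_ind => [|A e b vA eA wA IH].
  suff -> : eigen_vanishing [set: vertex G]%SET nu = 0%VS by rewrite dimv0.
  apply/eqP; rewrite -subv0; apply/subvP => x /eigen_vanishingP[_ x0].
  rewrite memv0; apply/eqP/cdata_eq0 => e.
  by split; apply: x0; rewrite /touches finset.inE.
set w := attach (e, ~~ b) in wA IH.
pose ends := [set z : endpoint | attach z == w]%SET.
pose B := (ends :\ (e, ~~ b))%SET.
have eB : (e, ~~ b) \in ends by rewrite finset.inE.
have cardB : #|B| = (degree w).-1 by rewrite /degree -/ends (cardsD1 (e, ~~ b) ends) eB.
(* One endpoint at w is left out: its derivative will follow from the Kirchhoff condition once the
   others vanish. *)
pose C := if [pick z in B] is Some z1 then (B :\ z1)%SET else B.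
have cardC : #|C| = (degree w - 2)%N.
  rewrite /C; case: pickP => [z1 z1B|B0].
    by have := cardsD1 z1 B; rewrite z1B cardB; lia.
  by rewrite cardB; have : #|B| = 0%N; [rewrite eq_card0 | lia].
have := dim_bigcap_lker (mem C)
  (fun z => linfun (fun x : coords G => end_der nu x z : R^o)) (eigen_vanishing A nu).
have linD z : linear (fun x : coords G => end_der nu x z : R^o).
  by move=> c y y'; exact: end_der_is_linear.
move/leq_trans; apply; rewrite (bigD1 w) //= addnC leq_add //.
  by rewrite -cardC; apply: eq_leq; apply: eq_card.
apply: leq_trans (leq_trans IH _); last first.
  apply: eq_leq; apply: eq_bigl => u; rewrite in_setU1 negb_or andbC.
  by congr andb.
apply: dimvS; apply/subvP => x; rewrite memv_cap [X in _ && X]mem_bigcap_lker.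
case/andP => /eigen_vanishingP[xE x0] /forall_inP derC.
have [cont dir kir] := eigenP _ _ _ xE.
have te : touches A e by rewrite /touches; case: (b) eA => ->; rewrite ?orbT.
have [val_e der_e] := @vanishing_end nu x (e, ~~ b) (fun c => x0 e c te).
have val_w z : attach z = w -> end_val nu x z = 0.
  by move=> zw; rewrite (cont z (e, ~~ b)).
have der_C z : z \in C -> end_der nu x z = 0.
  by move=> zC; have := derC z zC; rewrite linfun_linear // => /eqP.
have der_w z : attach z = w -> end_der nu x z = 0.
  move=> zw; have [->//|ze] := eqVneq z (e, ~~ b).
  have zB : z \in B by rewrite !finset.inE ze zw /=.
  move: der_C; rewrite /C; case: pickP => [z1 z1B|B0]; last by rewrite B0 in zB.
  have [->|zz1] := eqVneq z z1; last by apply; rewrite finset.in_setD1 zz1.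
  move=> der_C.
  (* Two distinct endpoints lie at w, so w is not pendant and the Kirchhoff condition holds
     there. *)
  have wD : w \notin D.
    apply/negP => /(fintype.subsetP Dp); rewrite finset.inE => /eqP dw.
    by move: cardB; rewrite dw (cardsD1 z1) z1B.
  move: (z1B); rewrite !finset.inE => /andP[z1e z1w].
  have := kir w wD; rewrite /kirchhoff (bigD1 z1) //= big1 ?addr0 //.
  move=> y /andP[/eqP yw yz1].
  have [->//|ye] := eqVneq y (e, ~~ b).
  by apply: der_C; rewrite !finset.inE yz1 ye yw /=.
apply/eigen_vanishingP; split => // e' c te'.
have [tA|ntA] := boolP (touches A e'); first exact: x0.
move: ntA te'; rewrite /touches negb_or => /andP[/negbTE nA1 /negbTE nA2].
rewrite !finset.inE nA1 nA2 !orbF => /orP[] /eqP aw.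
  exact: (end_vanishing (val_w _ aw) (der_w _ aw)).
exact: (end_vanishing (val_w _ aw) (der_w _ aw)).
Qed.

(** If every eigenfunction had zero derivative at the pendant Dirichlet vertex v, all would vanish
    on its edge, and [dim_eigen_vanishing] with A = {v} would bound the dimension by P + 2 beta -
    2. *)
Lemma exists_nonzero_kirchhoff nu : v \in D ->
  (2 * #|edge G| + #|pendant G| < \dim (eigen D nu) + 2 * #|vertex G|)%N ->
  exists2 x, x \in eigen D nu & kirchhoff nu v x != 0.
Proof.
move=> vD; rewrite -sum_excess ltn_add2r => lt; apply: contrapT => none.
have deg1 : degree v = 1%N.
  by have := fintype.subsetP Dp _ vD; rewrite finset.inE => /eqP.
have := dim_eigen_vanishing nu (finset.set11 v); apply/negP; rewrite -ltnNge.
move: lt; rewrite (bigD1 v) //= deg1 add0n => lt.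
apply: (@leq_trans (\dim (eigen D nu))).
  apply: leq_trans lt; rewrite ltnS; apply/eq_leq/eq_bigl => u.
  by rewrite finset.inE.
apply: dimvS; apply/subvP => x xE; apply/eigen_vanishingP; split => // e c te.
have kv0 : kirchhoff nu v x = 0.
  by apply/eqP/negPn/negP => kv; apply: none; exists x.
have [_ dir _] := eigenP _ _ _ xE.
have vend z : attach z = v -> cdata x (z.1, c) = 0.
  move=> zv; apply: (@end_vanishing nu); first by apply: dir; rewrite zv.
  move: kv0; rewrite /kirchhoff (bigD1 z) ?zv //= big1 ?addr0 // => y /andP[/eqP yv yz].
  have /eqP/cards1P[z' ends] := deg1.
  have : y \in [set z']%SET /\ z \in [set z']%SET by rewrite -ends !finset.inE yv zv.
  by rewrite !finset.inE => -[/eqP yz' /eqP zz']; rewrite yz' zz' eqxx in yz.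
move: te; rewrite /touches !finset.inE => /orP[] /eqP av; first exact: (vend (e, false)).
exact: (vend (e, true)).
Qed.

End Eigenfunctions.

End Propagation.

(** * Sharp eigenvalues *)

Section Indices.
Variables (R : realType) (G : metric_graph R) (D : {set vertex G}) (lambda : R).
Implicit Types (s : seq R) (n m k : nat).

Lemma eigenvalues_below_perm s s' : eigenvalues_below D lambda s ->
  eigenvalues_below D lambda s' -> perm_eq s s'.
Proof.
move=> [_ sl cs] [_ s'l cs']; apply/allP => nu _ /=; apply/eqP.
have [nul|lnu] := ltP nu lambda.
  by rewrite ((has_multiplicityP _ _ _).1 (cs nu nul))
             ((has_multiplicityP _ _ _).1 (cs' nu nul)).
have c0 t : all (fun nu => nu < lambda) t -> count_mem nu t = 0%N.
  move=> tl; apply/count_memPn/negP => /(allP tl) /=; by rewrite ltNge lnu.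
by rewrite !c0.
Qed.

Lemma is_eigenvalue_nrP s k : eigenvalues_below D lambda s ->
  is_eigenvalue_nr D k lambda <->
  (size s < k <= size s + \dim (eigen D lambda))%N.
Proof.
move=> sb; split=> [[s' [m [s'b /has_multiplicityP -> sk]]]|sk].
  by rewrite (perm_size (eigenvalues_below_perm sb s'b)).
by exists s, (\dim (eigen D lambda)); split => //; apply/has_multiplicityP.
Qed.

Lemma smallest_indexP s n : eigenvalues_below D lambda s ->
  smallest_index D n lambda <->
  n = (size s).+1 /\ (0 < \dim (eigen D lambda))%N.
Proof.
move=> sb; have nrP k := is_eigenvalue_nrP k sb.
split=> [[/nrP/andP[sn nm] nmin]|[-> m0]].
  have m0 : (0 < \dim (eigen D lambda))%N by lia.
  by split => //; apply/eqP; rewrite eqn_leq sn nmin //; apply/nrP; lia.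
split; first by apply/nrP; lia.
by move=> k /nrP/andP[].
Qed.

End Indices.

Section Sharp.
Variables (R : realType) (G : metric_graph R) (D : {set vertex G}) (v : vertex G).
Hypotheses (conn : connected_graph G) (Dp : D \subset pendant G) (vD : v \in D).
Variables (lambda : R) (n : nat).
Hypotheses (sharp : sharp_eigenvalue D lambda) (idx : smallest_index D n lambda).

Local Notation m := (\dim (eigen D lambda)).
Local Notation L := (total_length G).
Local Notation NB := ((nb_neumann D)%:Z + betti G).

Lemma total_length_gt0 : 0 < L.
Proof.
have [[e b] _] := attach_surj v.
rewrite /total_length (bigD1 e) //= ltr_wpDr ?subr_gt0 ?lo_lt_hi //.
by apply: sumr_ge0 => e' _; rewrite subr_ge0 ltW ?lo_lt_hi.
Qed.

Lemma nb_dirichlet_gt0 : (0 < nb_dirichlet D)%N.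
Proof. by apply/card_gt0P; exists v. Qed.

(** After taking square roots the bounds become linear in the indices and counts, hence additive
    over the pieces. *)
Lemma sqrt_bound (x : R) : 0 <= x -> lambda = pi ^+ 2 / L ^+ 2 * x ^+ 2 ->
  L * Num.sqrt lambda = pi * x.
Proof.
move=> x0 ->; have L0 := total_length_gt0.
have -> : pi ^+ 2 / L ^+ 2 * x ^+ 2 = (pi * x / L) ^+ 2.
  by field; rewrite gt_eqF.
rewrite sqrtr_sqr ger0_norm; first by field; rewrite gt_eqF.
by rewrite divr_ge0 ?mulr_ge0 ?pi_ge0 // ltW.
Qed.

Lemma sharp_roots : [/\ (0 < n)%N, (0 < m)%N, NB <= (n + m - 1)%:Z,
  L * Num.sqrt lambda = pi * (n%:R - 2 + (nb_dirichlet D)%:R +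
     ((nb_neumann D)%:R + (betti G)%:~R) / 2 + (betti G)%:~R) &
  L * Num.sqrt lambda = pi * ((n + m - 1)%:R -
     ((nb_neumann D)%:R + (betti G)%:~R) / 2)].
Proof.
have [n' [m' [_ /has_multiplicityP -> idx' [_ up] [_ low]]]] := sharp.
have n'n : n' = n.
  apply/eqP; rewrite eqn_leq (idx'.2 _ idx.1) (idx.2 _ idx'.1) //.
rewrite {}n'n {idx'} in up low.
have [s [m1 [sb _ _]]] := idx.1.
have [nE m0] := (smallest_indexP n sb).1 idx.
have n0 : (0 < n)%N by rewrite nE.
have d0 := nb_dirichlet_gt0; have b0 := betti_ge0 v conn.
have nb_real : ((nb_neumann D)%:R + (betti G)%:~R : R) = NB%:~R.
  by rewrite intrD.
have b0R : 0 <= (betti G)%:~R :> R by rewrite ler0z.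
have N0R : 0 <= (nb_neumann D)%:R :> R by rewrite ler0n.
have d0R : 1 <= (nb_dirichlet D)%:R :> R by rewrite ler1n.
have n0R : 1 <= n%:R :> R by rewrite ler1n.
have rootu : L * Num.sqrt lambda = pi * (n%:R - 2 + (nb_dirichlet D)%:R +
     ((nb_neumann D)%:R + (betti G)%:~R) / 2 + (betti G)%:~R).
  by apply: sqrt_bound up; lra.
have kR : (n + m - 1)%:R = (n + m - 1)%:Z%:~R :> R by [].
(* The branch n^2 / 4 is impossible: there the lower root is below (N + beta) / 2, while the upper
   root is at least that, as n and the number of Dirichlet vertices are at least 1. *)
move: low; rewrite /lower_bound gtn_eqF //=; case: ifPn => [lt|].
  have -> : (n + m - 1)%:R ^+ 2 / 4 = ((n + m - 1)%:R / 2) ^+ 2 :> R by field.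
  move=> /sqrt_bound; rewrite divr_ge0 ?ler0n // => /(_ isT); rewrite rootu.
  move/(mulfI (lt0r_neq0 (pi_gt0 R))).
  have : (n + m - 1)%:R < (nb_neumann D)%:R + (betti G)%:~R :> R.
    by rewrite nb_real kR ltr_int.
  by lra.
rewrite -leNgt => le /sqrt_bound rootl; split => //; apply: rootl.
have : (nb_neumann D)%:R + (betti G)%:~R <= (n + m - 1)%:R :> R.
  by rewrite nb_real kR ler_int.
by lra.
Qed.

(** The two roots in [sharp_roots] are equated; the numbers of Dirichlet and Neumann vertices add up
    to that of the pendant ones. *)
Lemma sharp_dim : (m + 1)%:Z = #|pendant G|%:Z + 2 * betti G.
Proof.
have [n0 m0 _ -> /(mulfI (lt0r_neq0 (pi_gt0 R)))] := sharp_roots.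
have -> : (n + m - 1)%:R = n%:R + m%:R - 1 :> R.
  by rewrite natrB ?natrD // addn_gt0 n0.
move=> e; apply/eqP; rewrite -(eqr_int R) !intrD intrM; apply/eqP.
have -> : #|pendant G| = (nb_dirichlet D + nb_neumann D)%N.
  by rewrite -(cardsID D) (finset.setIidPr Dp).
by rewrite PoszD intrD /= -!pmulrn; lra.
Qed.

(** By [sharp_dim] the multiplicity exceeds by one the bound for eigenfunctions with zero derivative
    at v. *)
Lemma sharp_kirchhoff : exists2 x, x \in eigen D lambda & kirchhoff lambda v x != 0.
Proof.
apply: (exists_nonzero_kirchhoff conn Dp) => //.
by have := sharp_dim; rewrite /betti; lia.
Qed.

End Sharp.

(** * Gluing sharp eigenvalues *)

(** Extended by zero, the eigenfunction of the i-th piece vanishes at the glued vertex, and only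
    that piece contributes to the Kirchhoff sum there. *)
Lemma glue_pole (R : realType) (p : nat) (p_gt1 : (1 < p)%N)
  (G : 'I_p -> metric_graph R) (v : forall i, vertex (G i))
  (D : forall i : 'I_p, {set vertex (G i)}) (lambda : R) (i : 'I_p) :
  (forall i, v i \in D i) ->
  (exists2 x, x \in eigen (D i) lambda & kirchhoff lambda (v i) x != 0) ->
  is_pole (glue_dirichlet p_gt1 v D) (None : vertex (Defs.glue p_gt1 v)) lambda.
Proof.
move=> vD [x xE kx]; pose y : coords (Defs.glue p_gt1 v) := embed p_gt1 v x.
have N := None_notin_dirichlet p_gt1 v D.
have : y \in eigen ((None : vertex (Defs.glue p_gt1 v)) |:
    glue_dirichlet p_gt1 v D)%SET lambda.
  apply/(mem_eigen_glue vD) => j; have [ji|ji] := eqVneq j i; last first.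
    by rewrite restrict_embed_neq // mem0v.
  by subst j; rewrite restrict_embed.
rewrite (mem_eigen_dirichlet N) => /andP[yW /eqP y0]; exists y => //; split => //.
rewrite kirchhoff_None (bigD1 i) //= restrict_embed big1 ?addr0 // => j ji.
by rewrite restrict_embed_neq // -(scale0r 0) kirZ mul0r.
Qed.

Theorem lemma3p1 (R : realType) (p : nat) (p_gt1 : (1 < p)%N)
  (G : 'I_p -> metric_graph R)
  (D : forall i : 'I_p, {set vertex (G i)})
  (v : forall i : 'I_p, vertex (G i))
  (G_connected : forall i : 'I_p, connected_graph (G i))
  (D_pendant : forall i : 'I_p, D i \subset pendant (G i))
  (v_in_D : forall i : 'I_p, v i \in D i)
  (lambda : R) (n : 'I_p -> nat)
  (lambda_sharp : forall i : 'I_p, sharp_eigenvalue (D i) lambda)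
  (lambda_index : forall i : 'I_p, smallest_index (D i) (n i) lambda) :
  sharp_eigenvalue (glue_dirichlet p_gt1 v D) lambda /\
  smallest_index (glue_dirichlet p_gt1 v D) (2 + \sum_(i < p) n i - p)%N lambda.
Proof.
set DD := glue_dirichlet p_gt1 v D; set n' := (2 + _ - p)%N.
have N : (None : vertex (Defs.glue p_gt1 v)) \notin DD := None_notin_dirichlet p_gt1 v D.
pose i0 : 'I_p := Ordinal (ltnW p_gt1).
pose m i : nat := \dim (eigen (D i) lambda).
have roots i := sharp_roots (G_connected i) (v_in_D i) (lambda_sharp i) (lambda_index i).
have low_root i : total_length (G i) * Num.sqrt lambda =
    pi * ((n i + m i - 1)%:R - ((nb_neumann (D i))%:R + (betti (G i))%:~R) / 2).
  by have [] := roots i.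
have up_root i : total_length (G i) * Num.sqrt lambda = pi * ((n i)%:R - 2 +
    (nb_dirichlet (D i))%:R + ((nb_neumann (D i))%:R + (betti (G i))%:~R) / 2 +
    (betti (G i))%:~R).
  by have [] := roots i.
have pole : is_pole DD (None : vertex (Defs.glue p_gt1 v)) lambda.
  apply: (@glue_pole _ _ _ _ _ _ _ i0 v_in_D).
  exact: (sharp_kirchhoff (G_connected i0) (D_pendant i0) (v_in_D i0)
    (lambda_sharp i0) (lambda_index i0)).
have [S SE] : exists S : 'I_p -> seq R, forall i, eigenvalues_below (D i) lambda (S i).
  have H i : exists s, eigenvalues_below (D i) lambda s.
    by have [[s [? [sb _ _]]] _] := lambda_index i; exists s.
  by have [S SE] := choice H; exists S.
have nE i : n i = (size (S i)).+1.
  by have [] := (smallest_indexP (n i) (SE i)).1 (lambda_index i).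
have m0 i : (0 < m i)%N by have [] := roots i.
(* The concatenated lists count the spectrum of the disjoint union below lambda. *)
have [||dimN [s [s_sorted sl ss scount]]] :=
  interlacing N (lambda := lambda) (s0 := \big[cat/[::]]_i S i) pole.
- by elim/big_rec: _ => // i t _ IH; rewrite all_cat IH andbT; case: (SE i).
- move=> nu nul; rewrite (dim_eigen_glue p_gt1 v_in_D).
  rewrite (big_morph _ (count_cat (pred1 nu)) (erefl : count_mem nu [::] = 0%N)).
  apply: eq_bigr => i _.
  by have [_ _ /(_ nu nul)/has_multiplicityP] := SE i.
have sb : eigenvalues_below DD lambda s.
  by split => // nu nul; apply/has_multiplicityP; rewrite scount.
have dimM : (\dim (eigen DD lambda)).+1 = (\sum_i m i)%N.
  exact: etrans dimN (dim_eigen_glue p_gt1 v_in_D lambda).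
rewrite (big_morph _ (@size_cat R) (erefl : size [::] = 0%N)) in ss.
have sum_n : (\sum_i n i = \sum_i size (S i) + p)%N.
  rewrite -[X in (_ + X)%N]card_ord -sum1_card -big_split /=.
  by apply: eq_bigr => i _; rewrite nE addn1.
(* The pieces have in total sum n_i - p eigenvalues below lambda, and gluing adds one; in particular
   the truncated subtraction in n' is exact. *)
have n'E : n' = (size s).+1 by rewrite /n' sum_n ss; lia.
have sum_m : (p <= \sum_i m i)%N.
  rewrite -{1}[p]card_ord -sum1_card; apply: leq_sum => i _; exact: m0.
have M0 : (0 < \dim (eigen DD lambda))%N by lia.
have index : smallest_index DD n' lambda by apply/(smallest_indexP _ sb).
split => //.
have l0 : 0 <= lambda by apply/ltW/(is_pole_gt0 N pole).
pose LL := total_length (Defs.glue p_gt1 v).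
have LL0 : 0 < LL by apply: total_length_gt0 (None : vertex (Defs.glue p_gt1 v)).
have bound x : LL * Num.sqrt lambda = pi * x -> lambda = pi ^+ 2 / LL ^+ 2 * x ^+ 2.
  move=> e; rewrite -{1}(sqr_sqrtr l0).
  have -> : Num.sqrt lambda = pi * x / LL by rewrite -e; field; rewrite gt_eqF.
  by field; rewrite gt_eqF.
pose sm (f : 'I_p -> R) := \sum_i f i.
have LLE : LL * Num.sqrt lambda = \sum_i (total_length (G i) * Num.sqrt lambda).
  by rewrite /LL total_length_glue mulr_suml.
have dE : (nb_dirichlet DD)%:R = sm (fun i => (nb_dirichlet (D i))%:R) - p%:R :> R.
  by rewrite /sm -natr_sum -(nb_dirichlet_glue p_gt1 v_in_D) natrD addrK.
have NE : (nb_neumann DD)%:R = sm (fun i => (nb_neumann (D i))%:R) :> R.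
  by rewrite /sm -natr_sum -(nb_neumann_glue p_gt1 v_in_D).
have bE : (betti (Defs.glue p_gt1 v))%:~R = sm (fun i => (betti (G i))%:~R) :> R.
  by rewrite /sm betti_glue rmorph_sum.
have n'R : n'%:R = 2 + sm (fun i => (n i)%:R) - p%:R :> R.
  by rewrite /sm -natr_sum natrB ?natrD // sum_n; lia.
(* One more eigenvalue below lambda and one less in multiplicity: the last indices simply add up. *)
have kE : (n' + \dim (eigen DD lambda) - 1 = \sum_i (n i + m i - 1))%N.
  have -> : (\sum_i (n i + m i - 1) = \sum_i size (S i) + \sum_i m i)%N.
    by rewrite -big_split; apply: eq_bigr => i _ /=; rewrite nE; lia.
  by lia.
exists n', (\dim (eigen DD lambda)); split => //; first exact: has_multiplicity_dim.
- split; first by case: index.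
  (* Upper roots add up: n' - 2 is sum n_i - p and p Dirichlet vertices are lost, which together
     account for the p constants -2. *)
  apply: bound; rewrite LLE (eq_bigr _ (fun i _ => up_root i)).
  rewrite -mulr_sumr; congr (_ * _); rewrite n'R dE NE bE /sm.
  rewrite !big_split /= -mulr_suml big_split sumr_const card_ord -mulr_natr /=.
  by lra.
- split; first by apply/(is_eigenvalue_nrP _ sb); rewrite n'E; lia.
  (* The last index is at least p >= 2, so the exceptional value at index 1, relevant if no
     Dirichlet vertex remains, does not occur. *)
  rewrite /lower_bound kE; have k2 : (2 <= \sum_i (n i + m i - 1))%N.
    apply: (leq_trans p_gt1); rewrite -{1}[p]card_ord -sum1_card.
    by apply: leq_sum => i _; rewrite nE; have := m0 i; lia.
  rewrite (@gtn_eqF 1) // andbF ifF; last first.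
    (* Summing N + beta <= n_i + m_i - 1 over the pieces selects the second branch. *)
    apply/negbTE; rewrite -leNgt (nb_neumann_glue p_gt1 v_in_D) // betti_glue.
    rewrite !(big_morph Posz PoszD (erefl (Posz 0))) -big_split /=.
    by apply: ler_sum => i _; have [_ _] := roots i.
  apply: bound; rewrite LLE (eq_bigr _ (fun i _ => low_root i)).
  rewrite -mulr_sumr; congr (_ * _); rewrite NE bE /sm natr_sum.
  by rewrite sumrB -mulr_suml big_split.
Qed.
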